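(* Let $\mathbf{d}\in\mathcal{D}$ and $T\in\mathbb{N}$. Then the following statements hold. (1) Suppose that $\mathcal{F}=\mathcal{F}(\mathbf{d},T)$ is a regular CIFS, and let $h_{\mathcal{F}}=\dim_H(J_{\mathcal{F}})$ and let $m_{\mathcal{F}}$ be the $h_{\mathcal{F}}$-conformal measure for $\mathcal{F}$. If $P_{\mathcal{F}}(h_{\mathcal{F}}/2)<\infty$, then $$\limsup_{r\downarrow 0}\frac{m_{\mathcal{F}}(B(0,r))}{r^{h_{\mathcal{F}}}}=0,\qquad \Pi_{h_{\mathcal{F}}}(J_{\mathcal{F}})=\infty.$$ (2) Suppose that $\mathcal{G}=\mathcal{G}(\mathbf{d},T)$ is a regular CIFS, and let $h_{\mathcal{G}}=\dim_H(J_{\mathcal{G}})$ and let $m_{\mathcal{G}}$ be the $h_{\mathcal{G}}$-conformal measure for $\mathcal{G}$. If $P_{\mathcal{G}}(h_{\mathcal{G}}/2)<\infty$, then $$\limsup_{r\downarrow 0}\frac{m_{\mathcal{G}}(B(0,r))}{r^{h_{\mathcal{G}}}}=0,\qquad \Pi_{h_{\mathcal{G}}}(J_{\mathcal{G}})=\infty.$$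
   Context: Notation. $\mathbb{N}$ is the set of positive integers, $\mathbb{D}=\{z\in\mathbb{C}:|z|<1\}$, $\mathbb{C}$ is identified with $\mathbb{R}^2$, $e(\theta)=e^{2\pi\sqrt{-1}\,\theta}$, $B(x,r)$ is the open ball. $\dim_H$ is Hausdorff dimension and $\Pi_t$ is the $t$-dimensional packing measure. CIFS. Let $X\subset\mathbb{R}^d$ be compact and connected and $I$ a countable (possibly finite) set with at least two elements. A family $\mathcal{S}=\{s_i:X\to X\}_{i\in I}$ of injective contractions is an IFS if $\sup_{i}\mathrm{Lip}(s_i)<1$. For $\omega=(\omega_1,\dots,\omega_N)\in I^N$ put $s_\omega=s_{\omega_1}\circ\dots\circ s_{\omega_N}$. The limit set is $J_{\mathcal{S}}=\bigcup_{\omega\in I^{\mathbb{N}}}\bigcap_{N\ge1}s_{\omega|_N}(X)$, where $\omega|_N=(\omega_1,\dots,\omega_N)$. An IFS $\mathcal{S}$ is a conformal IFS (CIFS) if: (Open Set Condition) $s_i(\mathrm{Int}\,X)\cap s_j(\mathrm{Int}\,X)=\emptyset$ for $i\ne j$; (Cone Condition) there are $0<\alpha<\pi/2$, $l>0$ such that for every $x\in\partial X$ there is $u_x\neq0$ with $\{y:0<|y-x|<l,\ \langle y-x,u_x\rangle>|y-x||u_x|\cos\alpha\}\subset\mathrm{Int}(X)$; (Conformality) there is an open connected $V\supset X$ such that all $s_i$ extend to $C^{1+\varepsilon}$ diffeomorphisms on $V$ that are conformal on $V$; (Bounded Distortion) there is $K\ge1$ with $|s_\omega'(y)|\le K|s_\omega'(x)|$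 for all $\omega\in\bigcup_N I^N$, $x,y\in V$, where $|s'_\omega(x)|$ is the operator norm of the derivative. Pressure and regularity. For a CIFS, $P_{\mathcal{S}}(t)=\lim_{N\to\infty}\frac1N\log\sum_{\omega\in I^N}\sup_{x\in X}|s_\omega'(x)|^t\in\mathbb{R}\cup\{\infty\}$ for $t\ge0$. $\mathcal{S}$ is regular if $P_{\mathcal{S}}(t)=0$ for some $t\ge0$. Conformal measure. For $t>0$, a Borel probability measure $m$ on $X$ is $t$-conformal for $\mathcal{S}$ if $m(J_{\mathcal{S}})=1$; $m(s_\omega(A))=\int_A|s_\omega'|^t\,dm$ for every $\omega\in\bigcup_N I^N$ and Borel $A\subset J_{\mathcal{S}}$; and $m(s_i(X)\cap s_j(X))=0$ for $i\neq j$. If $\mathcal{S}$ is a regular CIFS, there is a unique $h$-conformal measure with $h=\dim_H(J_{\mathcal{S}})$. The systems. $\mathcal{D}$ is the set of real sequences $\{d_n\}_{n\ge1}$ with $d_1\ge2$ and $d_{n+1}-d_n\ge2$ for all $n$. For $\alpha\in\mathbb{C}$, $|\alpha|\ge2$, define $f_\alpha,g_\alpha:\overline{\mathbb{D}}\to\overline{\mathbb{D}}$ by $f_\alpha(z)=\frac{z+\overline{\alpha}}{|\alpha|^2-1}$, $g_\alpha(z)=\frac1{z+\alpha}$. For $\mathbf{d}=\{d_n\}\in\mathcal{D}$, $T\in\mathbb{N}$: $\mathcal{F}(\mathbf{d},T)=\{f_{e(j/T)d_n}:n\in\mathbb{N},\,j=0,\dots,T-1\}$ and $\mathcal{G}(\mathbf{d},T)=\{g_{e(j/T)d_n}:n\in\mathbb{N},\,j=0,\dots,T-1\}$,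 families of maps on $X=\overline{\mathbb{D}}$. *)

(* Defs.v *)
(* The plane R^2 = C is the product R * R.  Its topology and differential ('d) are
   those of the library, and so is its product sigma-algebra, which is the Borel
   one.  The library norm on R * R is the sup norm, so the Euclidean norm [enorm]
   is introduced separately. *)
From HB Require Import structures.
From mathcomp Require Import all_boot all_order all_algebra.
From mathcomp Require Import complex.
From mathcomp Require Import all_classical all_reals all_analysis.
Import Order.TTheory GRing.Theory Num.Theory.
Import numFieldNormedType.Exports.

Set Implicit Arguments.
Unset Strict Implicit.
Unset Printing Implicit Defensive.

Local Open Scope classical_set_scope.
Local Open Scope ring_scope.

(* [measurableTypeR R] is [R] together with its Borel sigma-algebra. *)

Notation plane R := (measurableTypeR R * measurableTypeR R)%type.

Section Plane.
Context {R : realType}.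

Definition enorm (z : plane R) : R := Num.sqrt (z.1 ^+ 2 + z.2 ^+ 2).

Definition edot (z w : plane R) : R := z.1 * w.1 + z.2 * w.2.

Definition eball (x : plane R) (r : R) : set (plane R) :=
  [set y | enorm (y - x) < r].

Definition ecball (x : plane R) (r : R) : set (plane R) :=
  [set y | enorm (y - x) <= r].

Definition closed_disc : set (plane R) := [set z | enorm z <= 1].

Definition boundary (X : set (plane R)) : set (plane R) := closure X `\` interior X.

Definition toC (z : plane R) : R[i] := (z.1 +i* z.2)%C.

Definition ofC (z : R[i]) : plane R := (complex.Re z, complex.Im z).

Definition opnorm (L : plane R -> plane R) : R :=
  sup [set enorm (L v) | v in [set v | enorm v <= 1]].

(* |f'(x)| *)
Definition dnorm (f : plane R -> plane R) (x : plane R) : R := opnorm ('d f x).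

Definition lip (X : set (plane R)) (f : plane R -> plane R) : \bar R :=
  ereal_sup [set l | exists x y, [/\ X x, X y, x <> y &
    l = (enorm (f x - f y) / enorm (x - y))%:E]].

(* The outer [maxe] gives the empty set diameter 0. *)
Definition diam (U : set (plane R)) : \bar R :=
  maxe 0%E (ereal_sup [set (enorm (p.1 - p.2))%:E | p in U `*` U]).

End Plane.

Section HausdorffPacking.
Context {R : realType}.
Local Open Scope ereal_scope.

(* Countable families are indexed by subsets D of nat. *)
Definition hausdorff_pre (t delta : R) (A : set (plane R)) : \bar R :=
  ereal_inf [set c | exists (D : set nat) (U : nat -> set (plane R)),
    [/\ forall i, D i -> diam (U i) <= delta%:E,
        A `<=` \bigcup_(i in D) U i &
        c = \esum_(i in D) (poweR (diam (U i)) t)]].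

Definition hausdorff_measure (t : R) (A : set (plane R)) : \bar R :=
  ereal_sup [set hausdorff_pre t delta A | delta in [set delta | (0 < delta)%R]].

Definition hausdorff_dim (A : set (plane R)) : \bar R :=
  ereal_inf [set t%:E | t in [set t | (0 <= t)%R /\ hausdorff_measure t A = 0]].

(* Packings of A by disjoint closed balls centred in A, of diameter <= delta. *)
Definition packing_pre_delta (t delta : R) (A : set (plane R)) : \bar R :=
  ereal_sup [set c | exists (D : set nat) (x : nat -> plane R) (r : nat -> R),
    [/\ forall i, D i -> [/\ A (x i), (0 < r i)%R & (2 * r i <= delta)%R],
        trivIset D (fun i => ecball (x i) (r i)) &
        c = \esum_(i in D) (((2 * r i) `^ t)%R)%:E]].

Definition packing_pre (t : R) (A : set (plane R)) : \bar R :=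
  ereal_inf
    [set packing_pre_delta t delta A | delta in [set delta | (0 < delta)%R]].

(* [packing_pre] is not countably subadditive. *)
Definition packing_measure (t : R) (A : set (plane R)) : \bar R :=
  ereal_inf [set c | exists E : nat -> set (plane R),
    A `<=` \bigcup_k E k /\ c = \sum_(0 <= k <oo) packing_pre t (E k)].

End HausdorffPacking.

Section CIFS.
Context {R : realType}.

(* s_w = s_{w_1} \o ... \o s_{w_N}; [comp_word s [::]] is the identity. *)
Definition comp_word (I : Type) (s : I -> plane R -> plane R) (w : seq I) :
    plane R -> plane R :=
  foldr (fun i f => s i \o f) id w.

(* The maps X -> X are represented by total functions; only their values on X
   matter here. *)
Definition is_ifs (X : set (plane R)) (I : countType)
    (s : I -> plane R -> plane R) : Prop :=
  [/\ compact X, connected X, exists i j : I, i <> j,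
      forall i, s i @` X `<=` X /\ set_inj X (s i) &
      (ereal_sup (range (fun i => lip X (s i))) < 1)%E].

Definition limit_set (X : set (plane R)) (I : countType)
    (s : I -> plane R -> plane R) : set (plane R) :=
  \bigcup_(omega in [set: nat -> I])
    \bigcap_(N in [set N | (0 < N)%N]) (comp_word s (mkseq omega N) @` X).

Definition open_set_condition (X : set (plane R)) (I : countType)
    (s : I -> plane R -> plane R) : Prop :=
  forall i j, i <> j -> (s i @` (interior X)) `&` (s j @` (interior X)) = set0.

Definition cone_condition (X : set (plane R)) : Prop :=
  exists alpha l : R, [/\ 0 < alpha, alpha < pi / 2, 0 < l &
    forall x, boundary X x -> exists u : plane R, u <> 0 /\
      [set y | 0 < enorm (y - x) /\ enorm (y - x) < l /\
        enorm (y - x) * enorm u * cos alpha < edot (y - x) u] `<=` interior X].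

(* C^{1+eps} on an open set: the differential is locally eps-Hoelder. *)
Definition C1_eps (eps : R) (V : set (plane R)) (f : plane R -> plane R) :
    Prop :=
  (forall x, V x -> differentiable f x) /\
  (forall x, V x -> exists C r : R, 0 < r /\
    forall y z, V y -> V z -> eball x r y -> eball x r z ->
      opnorm (fun v => 'd f y v - 'd f z v) <= C * enorm (y - z) `^ eps).

Definition C1_eps_diffeo (eps : R) (V : set (plane R))
    (f : plane R -> plane R) : Prop :=
  exists g : plane R -> plane R,
    [/\ open (f @` V), forall x, V x -> g (f x) = x,
        C1_eps eps V f & C1_eps eps (f @` V) g].

(* The differential at every point is a similarity; orientation reversing maps
   are allowed. *)
Definition conformal_on (V : set (plane R)) (f : plane R -> plane R) : Prop :=
  forall x, V x -> exists2 lambda : R, 0 < lambda &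
    forall v, enorm ('d f x v) = lambda * enorm v.

(* A CIFS structure on the family s : the open set V and the extensions to V are
   data, so that derivatives make sense at boundary points of X.  The extensions
   map V into V, as the bounded distortion of the composites on V requires.
   By the cone condition X is the closure of its interior, so the differential
   of an extension at a point of X is determined by s. *)
Record cifs (X : set (plane R)) (I : countType)
    (s : I -> plane R -> plane R) := Cifs {
  cifs_dom : set (plane R);
  cifs_extn : I -> plane R -> plane R;
  cifs_ifs : is_ifs X s;
  cifs_osc : open_set_condition X s;
  cifs_cone : cone_condition X;
  cifs_open : open cifs_dom;
  cifs_connected : connected cifs_dom;
  cifs_sub : X `<=` cifs_dom;
  cifs_ext : forall i x, X x -> cifs_extn i x = s i x;
  cifs_stable : forall i, cifs_extn i @` cifs_dom `<=` cifs_dom;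
  cifs_diffeo : exists eps : R, [/\ 0 < eps, eps <= 1 &
    forall i, C1_eps_diffeo eps cifs_dom (cifs_extn i)];
  cifs_conformal : forall i, conformal_on cifs_dom (cifs_extn i);
  cifs_distortion : exists2 K : R, 1 <= K &
    forall (w : seq I) x y, (0 < size w)%N -> cifs_dom x -> cifs_dom y ->
      dnorm (comp_word cifs_extn w) y <= K * dnorm (comp_word cifs_extn w) x }.

Section Regularity.
Variables (X : set (plane R)) (I : countType) (s : I -> plane R -> plane R).

Definition word_dnorm (S : cifs X s) (w : seq I) (x : plane R) : R :=
  dnorm (comp_word (cifs_extn S) w) x.

Definition partition_sum (S : cifs X s) (N : nat) (t : R) : \bar R :=
  \esum_(w in [set: N.-tuple I])
    ereal_sup [set (word_dnorm S w x `^ t)%:E | x in X].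

(* The limit exists: the logarithms are subadditive in N. *)
Definition pressure (S : cifs X s) (t : R) : \bar R :=
  limn (fun N : nat => ((N%:R : R)^-1)%:E * lne (partition_sum S N t))%E.

Definition regular (S : cifs X s) : Prop :=
  exists2 t : R, 0 <= t & pressure S t = 0%E.

Definition conformal_measure (S : cifs X s) (t : R)
    (m : probability (plane R) R) : Prop :=
  [/\ 0 < t, m X = 1%E, m (limit_set X s) = 1%E,
      forall (w : seq I) (A : set (plane R)), (0 < size w)%N ->
        measurable A -> A `<=` limit_set X s ->
        m (comp_word s w @` A) =
          (\int[m]_(x in A) ((word_dnorm S w x `^ t)%R)%:E)%E &
      forall i j, i <> j -> m ((s i @` X) `&` (s j @` X)) = 0%E].

End Regularity.
End CIFS.

Section Systems.
Context {R : realType}.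

(* The sequence is indexed from 0: [d n] stands for d_{n+1}. *)
Definition gap_seq (d : nat -> R) : Prop :=
  2 <= d 0%N /\ forall n, 2 <= d n.+1 - d n.

(* e(theta) = exp(2 pi i theta) *)
Definition ecirc (theta : R) : R[i] :=
  (cos (2 * pi * theta) +i* sin (2 * pi * theta))%C.

Definition param (d : nat -> R) (T : nat) (k : nat * 'I_T) : R[i] :=
  ecirc (k.2%:R / T%:R) * (d k.1)%:C%C.

Definition f_map (alpha : R[i]) (z : plane R) : plane R :=
  ofC ((toC z + alpha^*%C) / (`|alpha| ^+ 2 - 1)).

Definition g_map (alpha : R[i]) (z : plane R) : plane R :=
  ofC ((toC z + alpha)^-1).

Definition sysF (d : nat -> R) (T : nat) (k : nat * 'I_T) :
    plane R -> plane R :=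
  f_map (param d k).

Definition sysG (d : nat -> R) (T : nat) (k : nat * 'I_T) :
    plane R -> plane R :=
  g_map (param d k).

End Systems.

(* Main.v *)
(* Each letter k acts on the disc X by a map with |s_k x - s_k y| =
   rho_k(x) rho_k(y) |x - y|, where rho_k is comparable to 1/a_k and a_k = d_n is
   the modulus of the parameter.  Multiplying along a word w gives a function D
   with |s_w x - s_w y| = D(x) D(y) |x - y|, and |s_w'| = D^2 on X.

   At 0: finiteness of the pressure at h/2 means that the sum of (a_k + 1)^-h
   converges.  The ball B(0,r) only meets the images of letters with
   a_k + 1 > 1/r, so m(B(0,r)) is at most a constant times the sum of a_k^-2h over
   these letters, hence at most r^h times the tail of a convergent series.

   Packing measure: by bounded distortion, each restriction to finitely many
   letters loses a fixed proportion of every cylinder, so the points whose code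
   uses only finitely many letters are m-null.  Almost every point is therefore of
   the form s_w(z) with z arbitrarily close to 0; the map s_w transports the
   thinness of m at 0 to a ball around that point, so that
   liminf m(B(x,r)) / r^h = 0 almost everywhere.  By a Vitali covering, a set of
   such points with finite packing premeasure is m-null, whereas countably many
   sets covering the limit set cannot all be null. *)
Require Import Defs.
From HB Require Import structures.
From mathcomp Require Import all_boot all_order all_algebra.
From mathcomp Require Import complex.
From mathcomp Require Import all_classical all_reals all_analysis.
From mathcomp Require Import measurable_realfun ring lra.
Import Order.TTheory GRing.Theory Num.Theory.
Import numFieldNormedType.Exports.
Local Open Scope classical_set_scope.
Local Open Scope ring_scope.

Set Implicit Arguments.
Unset Strict Implicit.

(** * The Euclidean plane *)

Section plane_geometry.
Context {R : realType}.
Implicit Types (x y z : plane R) (r : R).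

Lemma normc_toC z : `|toC z| = (enorm z)%:C%C.
Proof. by []. Qed.

Lemma toCD x y : toC (x + y) = toC x + toC y.
Proof. by []. Qed.

Lemma toCB x y : toC (x - y) = toC x - toC y.
Proof. by []. Qed.

Lemma enorm_ge0 z : 0 <= enorm z.
Proof. exact: sqrtr_ge0. Qed.

Lemma enormD x y : enorm (x + y) <= enorm x + enorm y.
Proof. by rewrite -lecR rmorphD /= -!normc_toC toCD ler_normD. Qed.

Lemma enormN z : enorm (- z) = enorm z.
Proof. by rewrite /enorm /= !sqrrN. Qed.

Lemma enormZ (k : R) z : enorm (k *: z) = `|k| * enorm z.
Proof.
rewrite /enorm /= -sqrtr_sqr -sqrtrM ?sqr_ge0//; congr Num.sqrt.
by rewrite /GRing.scale /= !exprMn mulrDr.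
Qed.

Lemma enorm0 : enorm (0 : plane R) = 0.
Proof. by rewrite /enorm /= expr0n /= addr0 sqrtr0. Qed.

Lemma enorm_eq0 z : (enorm z == 0) = (z == 0).
Proof.
apply/idP/eqP => [|->]; last by rewrite enorm0.
case: z => a b; rewrite /enorm /= sqrtr_eq0 => ab.
have := sqr_ge0 (a : R); have := sqr_ge0 (b : R) => b0 a0.
have /eqP a20 : (a : R) ^+ 2 == 0 by rewrite eq_le a0 andbT; lra.
have /eqP b20 : (b : R) ^+ 2 == 0 by rewrite eq_le b0 andbT; lra.
by move/eqP: a20 b20; rewrite sqrf_eq0 => /eqP -> /eqP; rewrite sqrf_eq0 => /eqP ->.
Qed.

Lemma enorm_gt0 z : (0 < enorm z) = (z != 0).
Proof. by rewrite lt_def enorm_ge0 andbT enorm_eq0. Qed.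

Lemma enormB x y : enorm (x - y) = enorm (y - x).
Proof. by rewrite -enormN opprB. Qed.

Lemma enorm_triangle y x z : enorm (x - z) <= enorm (x - y) + enorm (y - z).
Proof. by rewrite -[x in leLHS](subrK y) -addrA enormD. Qed.

Lemma ler_enorm_dist x y : `|enorm x - enorm y| <= enorm (x - y).
Proof.
have := enormD (x - y) y; have := enormD (y - x) x.
rewrite !subrK (enormB y x) ler_norml; lra.
Qed.

(** The library topology comes from the sup norm; this bound and the next one make the Euclidean
    norm equivalent to it. *)
Lemma norm_le_enorm z : `|z| <= enorm z.
Proof.
have h (a b : R) : `|a| <= Num.sqrt (a ^+ 2 + b ^+ 2).
  by rewrite -sqrtr_sqr ler_sqrt ?addr_ge0 ?sqr_ge0// lerDl sqr_ge0.
have -> : `|z| = Num.max `|z.1 : R| `|z.2 : R| by [].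
by rewrite ge_max {1}/enorm h /= /enorm addrC h.
Qed.

Lemma enorm_le_norm z : enorm z <= 2 * `|z|.
Proof.
have -> : `|z| = Num.max `|z.1 : R| `|z.2 : R| by [].
have : 0 <= Num.max `|z.1 : R| `|z.2 : R| by rewrite le_max normr_ge0.
have h1 : `|z.1 : R| <= Num.max `|z.1 : R| `|z.2 : R| by rewrite le_max lexx.
have h2 : `|z.2 : R| <= Num.max `|z.1 : R| `|z.2 : R| by rewrite le_max lexx orbT.
move: (Num.max _ _) h1 h2 => M h1 h2 M0.
have -> : 2 * M = Num.sqrt ((2 * M) ^+ 2).
  by rewrite sqrtr_sqr ger0_norm// mulr_ge0.
rewrite /enorm ler_sqrt ?sqr_ge0//.
have : (z.1 : R) ^+ 2 <= M ^+ 2 by rewrite -real_normK ?num_real// lerXn2r ?nnegrE.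
have : (z.2 : R) ^+ 2 <= M ^+ 2 by rewrite -real_normK ?num_real// lerXn2r ?nnegrE.
have := sqr_ge0 M; rewrite exprMn; lra.
Qed.

Lemma continuous_enorm : continuous (@enorm R).
Proof.
move=> x; apply/cvgrPdist_lt => e e0; near=> y.
apply: le_lt_trans (ler_enorm_dist _ _) _; apply: le_lt_trans (enorm_le_norm _) _.
rewrite -ltr_pdivlMl// ; near: y.
by apply: cvgr_dist_lt; [exact: cvg_id|rewrite mulr_gt0 ?invr_gt0].
Unshelve. all: by end_near. Qed.

Lemma continuous_enormB x : continuous (fun y => enorm (y - x)).
Proof.
move=> y; apply: (@continuous_comp _ _ _ (fun y => y - x));
  last exact: continuous_enorm.
by apply: cvgB; [exact: cvg_id|exact: cvg_cst].
Qed.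

Lemma open_eball x r : open (eball x r).
Proof.
have -> : eball x r = (fun y => enorm (y - x)) @^-1` [set t : R | t < r] by [].
by apply: open_comp => [y _|]; [exact: continuous_enormB|exact: open_lt].
Qed.

Lemma closed_ecball x r : closed (ecball x r).
Proof.
have -> : ecball x r = (fun y => enorm (y - x)) @^-1` [set t : R | t <= r] by [].
by apply: closed_comp => [y _|]; [exact: continuous_enormB|exact: closed_le].
Qed.

Lemma eball_sub_ecball x r : eball x r `<=` ecball x r.
Proof. by move=> y; rewrite /eball /ecball /= => /ltW. Qed.

Lemma sub_ecball_eball x r r' : r < r' -> ecball x r `<=` eball x r'.
Proof. by move=> rr' y; rewrite /ecball /eball /= => /le_lt_trans; exact. Qed.

(** An interior point of norm at least 1 could be pushed radially outwards by e / 4 without leaving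
    the disc, which is absurd. *)
Lemma interior_closed_disc : interior (@closed_disc R) = eball 0 1.
Proof.
apply/seteqP; split => x.
  rewrite /interior /=  -nbhs_ballE => -[e /= e0 eX].
  rewrite /eball /= subr0 ltNge; apply/negP => x1.
  have x0 : 0 < enorm x by lra.
  have : closed_disc ((1 + e / (4 * enorm x)) *: x).
    apply: eX; rewrite -ball_normE /= scalerDl scale1r opprD addNKr normrN.
    apply: le_lt_trans (norm_le_enorm _) _; rewrite enormZ ger0_norm; last first.
      by rewrite divr_ge0 ?mulr_ge0// ltW.
    have -> : e / (4 * enorm x) * enorm x = e / 4 by field; rewrite gt_eqF.
    by lra.
  have k0 : 0 < e / (4 * enorm x) by rewrite divr_gt0 ?mulr_gt0.
  rewrite /closed_disc /= enormZ ger0_norm; last by lra.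
  rewrite mulrDl mul1r; have := mulr_gt0 k0 x0; lra.
move=> x1; have : nbhs x (eball 0 1) by apply: open_nbhs_nbhs; split=> //;
  exact: open_eball.
by apply: filterS => y; rewrite /eball /closed_disc /= subr0 => /ltW.
Qed.

(** A ball is a union of segments issuing from its centre. *)
Lemma connected_eball x r : connected (eball x r).
Proof.
have [r0|r0] := ltP 0 r; last first.
  have -> : eball x r = set0.
    apply/seteqP; split => y //=; rewrite /eball /= => /(le_lt_trans (enorm_ge0 _)).
    lra.
  by move=> B -[y]; move=> + [C _ BE]; rewrite BE => -[].
have -> : eball x r = \bigcup_(y in eball x r)
    ((fun t : R => x + t *: (y - x)) @` `[0, 1]%classic).
  apply/seteqP; split => [y xy|y [z xz /= [t]]].
    exists y => //; exists 1; first by rewrite /= in_itv /= ler01 lexx.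
    by rewrite scale1r addrC subrK.
  rewrite in_itv /= => /andP[t0 t1 <-]; rewrite /eball /= addrAC subrr add0r enormZ.
  rewrite ger0_norm//; apply: le_lt_trans xz; rewrite -[leRHS]mul1r ler_wpM2r//.
  exact: enorm_ge0.
apply: bigcup_connected.
  exists x => y xy; exists 0; first by rewrite /= in_itv /= ler01 lexx.
  by rewrite scale0r addr0.
move=> y xy; apply: connected_continuous_connected; first exact: segment_connected.
apply: continuous_subspaceT => t.
apply: cvgD; first exact: cvg_cst.
by apply: cvgZ; [exact: cvg_id|exact: cvg_cst].
Qed.

End plane_geometry.

(** * Countable base, Lindelöf covers and Borel sets of the plane *)

Section borel_plane.
Context {R : realType}.

(** Boxes with rational centres and radii form the base. They are products of intervals, hence
    measurable for the product sigma-algebra, and so then is every open set. *)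
Lemma plane_second_countable : exists B : nat -> set (plane R),
  (forall i, measurable (B i)) /\
  forall U x, open U -> U x -> exists2 i, B i x & B i `<=` U.
Proof.
pose box (k : rat * rat * rat) : set (plane R) :=
  ball (ratr k.1.1 : R) (ratr k.2) `*` ball (ratr k.1.2 : R) (ratr k.2).
exists (fun i => oapp box set0 (unpickle i)); split.
  move=> i; case: unpickle => //= k.
  by apply: measurableX; apply: open_measurable; exact: ball_open.
move=> U x oU Ux; suff [k kx kU] : exists2 k, box k x & box k `<=` U.
  by exists (pickle k); rewrite pickleK.
have : nbhs x U by exact: open_nbhs_nbhs.
rewrite -nbhs_ballE => -[e /= e0 eU].
have [q /[!inE] /andP[q0 qe]] : exists q : rat, (ratr q : R) \in `]0, (e / 2)[.
  by apply: rat_in_itvoo; rewrite divr_gt0.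
rewrite !bnd_simp in q0 qe.
have ap (a : R) : exists p : rat, `|ratr p - a| < ratr q.
  have [p /[!inE] /andP[p1 p2]] :
      exists p : rat, (ratr p : R) \in `](a - ratr q), (a + ratr q)[.
    by apply: rat_in_itvoo; lra.
  by exists p; move: p1 p2; rewrite !bnd_simp ltr_norml => ? ?; lra.
have tri (a b c p f : R) : `|a - b| < p -> `|a - c| < p -> p < f / 2 -> `|b - c| < f.
  move=> ab ac pf; have := ler_normD (b - a) (a - c).
  by rewrite addrA subrK (distrC b a); lra.
have [p1 h1] := ap x.1; have [p2 h2] := ap x.2.
exists (p1, p2, q); first by split; rewrite /ball.
by move=> y [/= y1 y2]; apply: eU; split; [exact: tri h1 y1 qe|exact: tri h2 y2 qe].
Qed.

(** For every basic set contained in some [U x], one such [x] is kept. The default value 0 of [xget]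
    only occurs at indices outside [D]. *)
Lemma lindelof (E : set (plane R)) (U : plane R -> set (plane R)) :
  (forall x, E x -> open (U x) /\ U x x) ->
  exists (D : set nat) (x : nat -> plane R), (forall i, D i -> E (x i)) /\
    E `<=` \bigcup_(i in D) U (x i).
Proof.
move=> EU; have [B [_ BU]] := plane_second_countable.
pose P i := [set x | E x /\ B i `<=` U x].
exists [set i | P i !=set0], (fun i => xget 0 (P i)); split.
  by move=> i /= [x Px]; have /= [] := xgetPex 0 (ex_intro _ x Px).
move=> x Ex; have [oU Ux] := EU _ Ex.
have [i ix iU] := BU _ _ oU Ux.
have Px : P i x by [].
exists i; first by exists x.
by have /= [_] := xgetPex 0 (ex_intro _ x Px); exact.
Qed.

Lemma open_measurable_plane (U : set (plane R)) : open U -> measurable U.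
Proof.
move=> oU; have [B [mB BU]] := plane_second_countable.
have -> : U = \bigcup_(i in [set i | B i `<=` U]) B i.
  apply/seteqP; split => [x Ux|x [i /= iU]]; last exact: iU.
  by have [i ix iU] := BU _ _ oU Ux; exists i.
exact: bigcup_measurable.
Qed.

Lemma closed_measurable_plane (U : set (plane R)) : closed U -> measurable U.
Proof.
by move=> cU; rewrite -(setCK U); apply: measurableC; apply: open_measurable_plane;
  rewrite openC.
Qed.

Lemma compact_measurable_plane (U : set (plane R)) : compact U -> measurable U.
Proof.
move=> cU; apply: closed_measurable_plane; apply: compact_closed => //.
Qed.

End borel_plane.

(** * Packing measures *)

Section packing.
Context {R : realType}.
Implicit Types (x : nat -> plane R) (r : nat -> R).

(** Greedy selection: a ball of largest radius is kept, every ball meeting it lies in its threefold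
    enlargement, and the remaining balls are treated by induction. *)
Lemma vitali_finite x r (s : seq nat) :
  exists t : seq nat, [/\ uniq t, {subset t <= s},
    trivIset [set` t] (fun i => ecball (x i) (r i)) &
    forall i, i \in s -> exists2 j, j \in t &
      ecball (x i) (r i) `<=` ecball (x j) (3 * r j)].
Proof.
have [n] := ubnP (size s); elim: n s => // n IH [_|i0 s0 /ltnSE sn].
  by exists [::]; split.
set s := i0 :: s0.
have [i [si imax]] : exists i, i \in s /\ forall j, j \in s -> r j <= r i.
  have : s != [::] by [].
  elim: {sn} s => // a [_ _|b l IHl _].
    by exists a; rewrite mem_head; split => // j; rewrite inE => /eqP ->.
  have [//|i [bi im]] := IHl.
  have [ra|ra] := leP (r a) (r i).
    by exists i; rewrite inE bi orbT; split => // j; rewrite inE => /predU1P[->|/im].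
  exists a; rewrite mem_head; split => // j; rewrite inE => /predU1P[->//|/im].
  by move/le_trans; apply; exact: ltW.
pose disj j := `[< ecball (x i) (r i) `&` ecball (x j) (r j) = set0 >].
(* The test [j != i] is separate because a ball of negative radius is empty, hence disjoint from
   itself; it makes the list strictly shorter. *)
have [|t [ut ts tt th]] := IH [seq j <- s | disj j & j != i].
  rewrite (leq_ltn_trans _ sn)// size_filter -ltnS.
  have -> : (size s0).+1 = size s by []. 
  by rewrite ltn_neqAle count_size andbT -all_count; apply/allPn; exists i => //;
    rewrite eqxx andbF.
exists (i :: t); split.
- by rewrite /= ut andbT; apply/negP => /ts; rewrite mem_filter eqxx andbF.
- by move=> j; rewrite inE => /predU1P[->//|/ts]; rewrite mem_filter => /andP[].
- apply/trivIsetP => a b; rewrite /= !inE => /predU1P[->|at_] /predU1P[->|bt] ab.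
  + by rewrite eqxx in ab.
  + by have := ts _ bt; rewrite mem_filter => /andP[/andP[/asboolP]].
  + by have := ts _ at_; rewrite mem_filter setIC => /andP[/andP[/asboolP]].
  + by move/trivIsetP : tt; apply.
- move=> j js; have [ji|ji] := eqVneq j i.
    exists i; rewrite ?mem_head// ji => y; rewrite /ecball /= => yi.
    have := enorm_ge0 (y - x i); lra.
  have [dj|/asboolPn/eqP/set0P[z [zi zj]]] := boolP (disj j).
    have [|k kt jk] := th j; first by rewrite mem_filter dj ji.
    by exists k; rewrite // inE kt orbT.
  exists i; rewrite ?mem_head// => y; move: zi zj; rewrite /ecball /= => zi zj yj.
  have := enorm_triangle z y (x i); have := enorm_triangle (x j) y z.
  rewrite (enormB (x j) z); have := imax _ js; lra.
Qed.

Lemma packing_pre_delta_ge (t delta : R) (A : set (plane R)) x r (s : seq nat) :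
  uniq s -> (forall i, i \in s -> [/\ A (x i), 0 < r i & 2 * r i <= delta]) ->
  trivIset [set` s] (fun i => ecball (x i) (r i)) ->
  (\sum_(i <- s) ((2 * r i) `^ t)%:E <= packing_pre_delta t delta A)%E.
Proof.
move=> us sA st; apply: ereal_sup_ubound; exists [set` s], x, r; split => //.
rewrite esum_fset; [|exact: finite_seq|by move=> i _; rewrite lee_fin powR_ge0].
by rewrite fsbig_seq.
Qed.

Lemma packing_pre_delta_ge0 (t delta : R) (A : set (plane R)) :
  (0 <= packing_pre_delta t delta A)%E.
Proof.
have := @packing_pre_delta_ge t delta A (fun=> 0) (fun=> 0) [::].
rewrite big_nil; apply => //; exact: trivIset_set0.
Qed.

Lemma packing_pre_ge0 (t : R) (A : set (plane R)) : (0 <= packing_pre t A)%E.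
Proof.
by apply: le_ereal_inf_tmp => _ [delta _ <-]; exact: packing_pre_delta_ge0.
Qed.

(** Around each point a ball is chosen whose threefold enlargement has mass at most e r^h. The
    disjoint balls selected by Vitali form a packing, so the covered mass is at most e times a
    finite packing premeasure, with e arbitrary. *)
Lemma packing_pre_negligible (m : probability (plane R) R) (h : R)
    (A E : set (plane R)) :
  0 <= h -> E `<=` A -> (packing_pre h A < +oo)%E ->
  (forall z, E z -> forall e delta : R, 0 < e -> 0 < delta ->
    exists r : R, [/\ 0 < r, r <= delta &
      (m (ecball z (3 * r)) <= (e * r `^ h)%:E)%E]) ->
  m.-negligible E.
Proof.
move=> h0 EA /ereal_inf_lt[_ [delta /= delta0 <-]] Poo thin.
have [M PM] : exists M : R, packing_pre_delta h delta A = M%:E.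
  have := packing_pre_delta_ge0 h delta A; move: Poo.
  by case: (packing_pre_delta h delta A) => // M _ _; exists M.
have M0 : 0 <= M by rewrite -lee_fin -PM packing_pre_delta_ge0.
suff cover (e : R) : 0 < e ->
    exists U, [/\ measurable U, E `<=` U & (m U <= (e * M)%:E)%E].
  have {cover} /choice[U hU] : forall n : nat, exists U,
      [/\ measurable U, E `<=` U & (m U <= (n.+1%:R^-1 * M)%:E)%E].
    by move=> n; apply: cover; rewrite invr_gt0.
  have mU : measurable (\bigcap_n U n) by apply: bigcapT_measurable => n; case: (hU n).
  exists (\bigcap_n U n); split => //; last first.
    by move=> x Ex n _; have [_ EU _] := hU n; exact: EU.
  apply/eqP; rewrite eq_le measure_ge0 andbT; apply/lee_addgt0Pr => e e0; rewrite add0e.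
  have [n Mn] : exists n : nat, M / e < n.+1%:R.
    by exists (Num.truncn (M / e)); exact: truncnS_gt.
  have [mUn _ Un] := hU n.
  apply: (@le_trans _ _ (m (U n))); first by apply: le_measure; rewrite ?inE// => y;
    apply.
  apply: le_trans Un _; rewrite lee_fin mulrC ler_pdivrMr//.
  by rewrite mulrC -ler_pdivrMr// ltW.
move=> e0.
(* Radii are at most [delta / 2] because packings bound the diameter. Points outside [E] get the
   dummy radius 0. *)
have hthin : forall z, exists r : R, E z -> [/\ 0 < r, r <= delta / 2 &
      (m (ecball z (3 * r)) <= (e * r `^ h)%:E)%E].
  move=> z; have [Ez|nEz] := pselect (E z); last by exists 0.
  by have [|r hr] := thin z Ez e (delta / 2) e0; [lra|exists r].
have {hthin} /choice[r hr] := hthin.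
have oE z : E z -> open (eball z (r z)) /\ eball z (r z) z.
  by case/hr => r0 _ _; split; [exact: open_eball|rewrite /eball /= subrr enorm0].
have [D [x [Dx DE]]] := lindelof oE.
pose B i := if `[< D i >] then eball (x i) (r (x i)) else set0.
have mB i : measurable (B i).
  by rewrite /B; case: ifP => // _; apply: open_measurable_plane; exact: open_eball.
have mV n : measurable (\big[setU/set0]_(i < n) B i) by apply: bigsetU_measurable.
have mVoo : measurable (\bigcup_n \big[setU/set0]_(i < n) B i).
  by apply: bigcupT_measurable.
exists (\bigcup_n \big[setU/set0]_(i < n) B i); split => //.
  move=> z /DE[i Di zi]; exists i.+1 => //; rewrite -bigcup_mkord; exists i => //=.
  by rewrite /B asboolT.
have ndV : nondecreasing_seq (fun n => \big[setU/set0]_(i < n) B i).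
  by move=> a b ab; apply/subsetPset; exact: subset_bigsetU.
(* Continuity from below reduces the bound to finite unions, to which the finite Vitali selection
   applies. *)
have cm := nondecreasing_cvg_mu (mu := m) mV mVoo ndV.
rewrite -(cvg_lim _ cm)//; apply: lime_le; first by apply/cvg_ex; eexists; exact: cm.
near=> n; rewrite /=.
have [t [ut ts tt th]] := vitali_finite x (r \o x) [seq i <- iota 0 n | `[< D i >]].
have tD i : i \in t -> D i by move/ts; rewrite mem_filter => /andP[/asboolP].
apply: (@le_trans _ _ (\sum_(i <- t) m (ecball (x i) (3 * r (x i))))%E).
  apply: (@le_trans _ _ (m (\big[setU/set0]_(i <- t) ecball (x i) (3 * r (x i))))).
    apply: le_measure; rewrite ?inE//; first exact: mV.
      by apply: bigsetU_measurable => i _; apply: closed_measurable_plane;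
        exact: closed_ecball.
    rewrite -bigcup_mkord => z [i /= ni]; rewrite /B; case: asboolP => // Di zi.
    have [|j jt] := th i; first by rewrite mem_filter asboolT//= mem_iota.
    move/(_ _ (eball_sub_ecball zi)) => zj.
    by rewrite -bigcup_seq; exists j.
  elim: {ut ts tt th tD} t => [|i t IH]; first by rewrite !big_nil measure0.
  rewrite !big_cons; apply: le_trans (leeD (le_refl _) IH).
  apply: measureU2.
    by apply: closed_measurable_plane; exact: closed_ecball.
  by apply: bigsetU_measurable => j _; apply: closed_measurable_plane;
    exact: closed_ecball.
apply: (@le_trans _ _ (\sum_(i <- t) (e%:E * ((2 * r (x i)) `^ h)%:E))%E).
  rewrite big_seq [leRHS]big_seq; apply: lee_sum => i /tD/Dx/hr[ri _ hi].
  apply: le_trans hi _; rewrite -EFinM lee_fin ler_pM2l// ge0_ler_powR// ?nnegrE; lra.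
rewrite -ge0_sume_distrr; last by move=> i _; rewrite lee_fin powR_ge0.
rewrite EFinM -PM; apply: lee_wpmul2l; first by rewrite lee_fin ltW.
apply: (@packing_pre_delta_ge _ _ _ x (r \o x)) => // i it.
have Exi := Dx i (tD i it); have [? ? _] := hr _ Exi.
by split => //; [exact: EA|rewrite /=; lra].
Unshelve. all: by end_near. Qed.

(** A countable cover with finite total premeasure would have every piece of finite premeasure,
    hence null off [N], and [J] itself would be null. *)
Lemma packing_measure_pinfty (m : probability (plane R) R) (h : R)
    (J N : set (plane R)) :
  0 <= h -> measurable J -> m J = 1%E -> m.-negligible N ->
  (forall z, (J `\` N) z -> forall e delta : R, 0 < e -> 0 < delta ->
    exists r : R, [/\ 0 < r, r <= delta &
      (m (ecball z (3 * r)) <= (e * r `^ h)%:E)%E]) ->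
  packing_measure h J = +oo%E.
Proof.
move=> h0 mJ mJ1 N0 thin; apply/eqP; rewrite eq_le leey /=.
apply: le_ereal_inf_tmp => _ [E [JE ->]]; rewrite leNgt; apply/negP => Soo.
have Efin k : (packing_pre h (E k) < +oo)%E.
  apply: le_lt_trans Soo;
    apply: (@le_trans _ _ (\sum_(0 <= i < k.+1) packing_pre h (E i))%E).
    rewrite big_nat_recr//= leeDr// sume_ge0// => i _; exact: packing_pre_ge0.
  by apply: nneseries_lim_ge => i _ _; exact: packing_pre_ge0.
have nJ : m.-negligible J.
  apply: (@negligibleS _ _ _ m (N `|` \bigcup_k (E k `&` (J `\` N)))).
    move=> z Jz; have [Nz|nNz] := pselect (N z); [by left|right].
    by have [k _ Ekz] := JE _ Jz; exists k.
  apply: negligibleU => //; apply: negligible_bigcup => k.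
  apply: (@packing_pre_negligible m h (E k)) => //; last by move=> z [_ JNz];
    exact: thin.
have : m J = 0%E by apply/(@measure_negligible _ _ _ m).
by rewrite mJ1 => /eqP; rewrite onee_eq0.
Qed.

End packing.

(** * Words of a disc system *)

Section word_maps.
Context {R : realType}.
Implicit Types (V X : set (plane R)).

Lemma comp_word_cat (I : Type) (s : I -> plane R -> plane R) (v w : seq I) z :
  comp_word s (v ++ w) z = comp_word s v (comp_word s w z).
Proof. by elim: v => //= k v ->. Qed.

Lemma opnorm_similarity (L : plane R -> plane R) (l : R) : 0 <= l ->
  (forall v, enorm (L v) = l * enorm v) -> opnorm L = l.
Proof.
move=> l0 Ll; rewrite /opnorm.
have e1 : enorm ((1, 0) : plane R) = 1.
  by rewrite /enorm /= expr1n expr0n /= addr0 sqrtr1.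
have ub : ubound [set enorm (L v) | v in [set v | enorm v <= 1]] l.
  by move=> _ [v /= v1 <-]; rewrite Ll ler_piMr.
apply/eqP; rewrite eq_le; apply/andP; split.
  apply: ge_sup => //; exists (enorm (L (1, 0))); exists (1, 0) => //=.
  by rewrite e1.
apply: ub_le_sup; first by exists l.
by exists (1, 0); rewrite /= ?e1// Ll e1 mulr1.
Qed.

(** The limit is one-sided because from a boundary point of the disc one can move inwards along a
    ray, but not along its opposite. *)
Lemma diff_quotient_cvg (f : plane R -> plane R) x v : differentiable f x ->
  (enorm (t^-1 *: (f (t *: v + x) - f x)) @[t --> 0^'+] -->
    enorm ('d f x v) : Prop).
Proof.
move=> df; have fd := @diff_derivable _ _ _ f x v df.
have fc : t^-1 *: ((f \o shift x) (t *: v) - f x) @[t --> 0^'] --> 'd f x v.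
  by rewrite -deriveE//; apply: cvg_toP.
have : t^-1 *: (f (t *: v + x) - f x) @[t --> 0^'+] --> 'd f x v.
  apply: cvg_trans fc; apply: cvg_app => /= A [e /= e0 eA]; exists e => // t te t0.
  by apply: eA => //; rewrite gt_eqF.
by move/cvg_comp; apply; exact: continuous_enorm.
Qed.

End word_maps.

(** Abstracts the common features of the two families, so that one argument serves both. The
    symmetric two-point factor stands in for the derivative and makes sense up to the boundary
    circle. *)
Record disc_system (R : realType) (I : choiceType) (s : I -> plane R -> plane R)
    (a : I -> R) (rho : I -> plane R -> R) : Prop := DiscSystem {
  disc_a_ge2 : forall k, 2 <= a k;
  disc_dist : forall k x y, closed_disc x -> closed_disc y ->
    enorm (s k x - s k y) = rho k x * rho k y * enorm (x - y);
  disc_rho_bounds : forall k x, closed_disc x ->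
    (a k + 1)^-1 <= rho k x <= (a k - 1)^-1;
  disc_image_bounds : forall k x, closed_disc x ->
    (a k + 1)^-1 <= enorm (s k x) <= (a k - 1)^-1;
  disc_a_finite : forall M, finite_set [set k | a k <= M];
  disc_a_unbounded : forall M, exists k, M < a k }.

Section disc_words.
Context {R : realType} {I : countType}.
Variables (s : I -> plane R -> plane R) (a : I -> R) (rho : I -> plane R -> R).
Hypothesis sys : disc_system s a rho.
Let X : set (plane R) := closed_disc.
Implicit Types (v w : seq I) (x y : plane R) (k : I).

Local Notation J := (limit_set closed_disc s).

Lemma closed_disc0 : X 0.
Proof. by rewrite /X /closed_disc /= enorm0. Qed.

Lemma a_gt1 k : 1 < a k. Proof. have := disc_a_ge2 sys k; lra. Qed.

Lemma letter_stable k x : X x -> X (s k x).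
Proof.
move=> /(disc_image_bounds sys k) /andP[_ /le_trans]; apply.
by rewrite invf_le1; have := disc_a_ge2 sys k; lra.
Qed.

Lemma word_stable w x : X x -> X (comp_word s w x).
Proof. by move=> Xx; elim: w => //= k w; exact: letter_stable. Qed.

(** The factors follow the chain rule: each letter is evaluated at the image of [x] under the
    letters to its right. The square of the product is the derivative norm, see [word_dnormE]. *)
Fixpoint mult w x : R :=
  if w is k :: w' then rho k (comp_word s w' x) * mult w' x else 1.

Lemma word_dist w x y : X x -> X y ->
  enorm (comp_word s w x - comp_word s w y) = mult w x * mult w y * enorm (x - y).
Proof.
move=> Xx Xy; elim: w => [|k w IH] /=; first by rewrite !mul1r.
rewrite (disc_dist sys); [|exact: word_stable|exact: word_stable].
by rewrite IH; ring.
Qed.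

Lemma mult_bounds w x : X x ->
  \prod_(k <- w) (a k + 1)^-1 <= mult w x <= \prod_(k <- w) (a k - 1)^-1.
Proof.
move=> Xx; elim: w => [|k w /andP[IH1 IH2]]; first by rewrite !big_nil lexx.
rewrite !big_cons /=.
have /andP[r1 r2] := disc_rho_bounds sys k (word_stable w Xx).
have p0 : 0 <= (a k + 1)^-1 by rewrite invr_ge0; have := a_gt1 k; lra.
have q0 : 0 <= \prod_(k <- w) (a k + 1)^-1.
  by apply: prodr_ge0 => i _; rewrite invr_ge0; have := a_gt1 i; lra.
by rewrite !ler_pM//; [exact: le_trans p0 r1|exact: le_trans q0 IH1].
Qed.

Lemma mult_gt0 w x : X x -> 0 < mult w x.
Proof.
move=> /(mult_bounds w) /andP[+ _]; apply: lt_le_trans; apply: prodr_gt0 => k _.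
by rewrite invr_gt0; have := a_gt1 k; lra.
Qed.

Lemma mult_le1 w x : X x -> mult w x <= 1.
Proof.
move=> /(mult_bounds w) /andP[_] /le_trans; apply.
apply: prodr_ile1 => k _; have := disc_a_ge2 sys k => ak.
by rewrite invr_ge0 invf_le1; lra.
Qed.

Lemma word_inj w x y : X x -> X y ->
  comp_word s w x = comp_word s w y -> x = y.
Proof.
move=> Xx Xy E; apply/eqP; rewrite -subr_eq0 -enorm_eq0.
have := word_dist w Xx Xy; rewrite E subrr enorm0 => /esym/eqP.
rewrite !mulf_eq0 => /orP[/orP[]|//]; by rewrite gt_eqF// mult_gt0.
Qed.

Lemma letter_inj k x y : X x -> X y -> s k x = s k y -> x = y.
Proof. exact: (@word_inj [:: k]). Qed.

Lemma word_imageI w (A B : set (plane R)) : A `<=` X -> B `<=` X ->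
  comp_word s w @` (A `&` B) = (comp_word s w @` A) `&` (comp_word s w @` B).
Proof.
move=> AX BX; apply/seteqP; split => [_ [x [Ax Bx] <-]|y [[x Ax <-] [z Bz zx]]].
  by split; exists x.
have xz : z = x by apply: (@word_inj w); [exact: BX|exact: AX|].
by exists x => //; split => //; rewrite -xz.
Qed.

Lemma limit_set_sub : J `<=` X.
Proof.
by move=> x [omega _ /(_ 1%N isT)] [z Xz <-]; exact: word_stable.
Qed.

(** The shifted sequence codes the preimage of a point, so the preimage lies again in the limit set;
    injectivity shows that the preimages taken at different levels agree. *)
Lemma limit_set_coded x : J x <-> exists omega : nat -> I, forall N,
  exists2 z, J z & comp_word s (mkseq omega N) z = x.
Proof.
split=> [[omega _ xo]|[omega xo]]; last first.
  by exists omega => // N N0; have [z /limit_set_sub Xz <-] := xo N; exists z.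
have {}xo N : (comp_word s (mkseq omega N) @` X) x.
  by case: N => [|N]; [exists x => //; have [z Xz <-] := xo 1%N isT;
    exact: word_stable|exact: xo].
exists omega => N; have [z Xz zx] := xo N; exists z => //.
exists (fun i => omega (N + i)%N) => // M _; have [y Xy yx] := xo (N + M)%N.
exists y => //; apply: (@word_inj (mkseq omega N)) => //; first exact: word_stable.
rewrite zx -yx -comp_word_cat; congr (comp_word s _ y).
rewrite /mkseq iotaD map_cat add0n; congr (_ ++ _).
by rewrite -[in RHS](addn0 N) iotaDl -map_comp.
Qed.

Lemma word_limit_set w : comp_word s w @` J `<=` J.
Proof.
have h k : s k @` J `<=` J.
  move=> _ [x /[dup] Jx /limit_set_coded[omega xo] <-]; apply/limit_set_coded.
  exists (fun n => if n is n'.+1 then omega n' else k) => -[|N].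
    exists (s k x) => //;
      exists (fun n => if n is n'.+1 then omega n' else k) => // -[//|N] _.
    have [z /limit_set_sub Xz <-] := xo N; exists z => //=.
    by rewrite /mkseq /= -[1%N]addn0 iotaDl -map_comp.
  have [z Jz <-] := xo N; exists z => //=.
  by rewrite /mkseq /= -[1%N]addn0 iotaDl -map_comp.
elim: w => [|k w IH]; first by rewrite image_id.
by move=> _ [x Jx <-] /=; apply: (h k); exists (comp_word s w x) => //; apply: IH;
  exists x.
Qed.

Lemma letter_limit_set k : s k @` J `<=` J.
Proof. exact: (@word_limit_set [:: k]). Qed.

Lemma limit_set_letter x : J x -> exists k, (s k @` J) x.
Proof. by move=> /limit_set_coded[omega /(_ 1%N)]; exists (omega 0%N). Qed.

(** The limit set is an uncountable union over sequences. This set involves only countable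
    operations on words, which gives measurability once the two are shown equal. *)
Definition word_hull : set (plane R) :=
  \bigcap_N \bigcup_(w in [set w : seq I | size w = N]) (comp_word s w @` X).

Lemma word_hull_sub : word_hull `<=` X.
Proof. by move=> y /(_ 0%N Logic.I) [w _ [z Xz <-]]; exact: word_stable. Qed.

(* A point lies in finitely many first-level images, so one of the letters
   works for all levels at once. *)
Lemma word_hull_letter x : word_hull x -> exists k, (s k @` word_hull) x.
Proof.
move=> hx.
have first N : exists k,
    (s k @` \bigcup_(w in [set w : seq I | size w = N]) (comp_word s w @` X)) x.
  have [[//|k w] /= [wN] [z Xz zx]] := hx N.+1 Logic.I.
  by exists k; exists (comp_word s w z) => //; exists w => //; exists z.
(* The unions decrease with the level, so membership at infinitely many levels gives membership at
   all of them. *)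
have decr M N : (M <= N)%N ->
   \bigcup_(w in [set w : seq I | size w = N]) (comp_word s w @` X) `<=`
   \bigcup_(w in [set w : seq I | size w = M]) (comp_word s w @` X).
  move=> MN y [w /= wN [z Xz zy]]; exists (take M w);
    first by rewrite /= size_takel ?wN.
  exists (comp_word s (drop M w) z); first exact: word_stable.
  by rewrite -comp_word_cat cat_take_drop.
have [k0 [y0 [w0 _ [z0 Xz0 zy0]] y0x]] := first 0%N.
have x0 : 0 < enorm x.
  have /andP[+ _] := disc_image_bounds sys k0 (word_stable w0 Xz0).
  rewrite zy0 y0x; apply: lt_le_trans; rewrite invr_gt0; have := a_gt1 k0; lra.
have /choice[k hk] := first.
have kfin N : a (k N) <= (enorm x)^-1 + 1.
  have [y [w _ [z Xz zy]] yx] := hk N.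
  have /andP[_] := disc_image_bounds sys (k N) (word_stable w Xz).
  rewrite zy yx -lerBlDr => h; rewrite -[leLHS]invrK lef_pV2// posrE invr_gt0.
  have := a_gt1 (k N); lra.
(* Pigeonhole: all first letters lie in a finite set, so one of them serves infinitely many
   levels. *)
have [k1 k1inf] : exists k1, forall N, exists2 M, (N <= M)%N & k M = k1.
  apply: contrapT => /forallNP nk.
  have /choice[N hN] : forall k1, exists N, forall M, (N <= M)%N -> k M <> k1.
    move=> k1; have /existsNP[N hN] := nk k1; exists N => M NM kM; apply: hN.
    by exists M.
  have /finite_seqP[t ht] := disc_a_finite sys ((enorm x)^-1 + 1).
  pose M := (\max_(k1 <- t) N k1)%N.
  have kt : k M \in t by suff : [set` t] (k M) by []; rewrite -ht; exact: kfin.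
  by apply: (hN (k M) M) => //; exact: leq_bigmax_seq.
exists k1; have [M _ kM] := k1inf 0%N; have [u [w' _ [z' Xz' zu]] ux] := hk M.
rewrite kM in ux; have Xu : X u by rewrite -zu; exact: word_stable.
exists u => // N _; have [M' NM' kM'] := k1inf N.
apply: (decr _ _ NM'); have [u' hu' u'x] := hk M'.
rewrite kM' in u'x.
(* Injectivity of the common letter makes the preimages found at different levels a single point. *)
suff -> : u = u' by [].
apply: (@letter_inj k1) => //; last by rewrite ux.
by have [v _ [t Xt <-]] := hu'; exact: word_stable.
Qed.

(** For the inclusion of the hull, preimages inside the hull are taken repeatedly; the letters met
    on the way form a code. *)
Lemma limit_set_hull : J = word_hull.
Proof.
apply/seteqP; split => [x /limit_set_coded[omega xo] N _|x hx].
  have [z /limit_set_sub Xz zx] := xo N; exists (mkseq omega N);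
    first by rewrite /= size_mkseq.
  by exists z.
(* Outside the hull [f] returns an arbitrary letter; the orbit of [x] never leaves the hull. *)
have /choice[f hf] : forall y, exists kz : I * plane R, word_hull y ->
  word_hull kz.2 /\ s kz.1 kz.2 = y.
  move=> y; have [hy|] := pselect (word_hull y);
    last by have [k _] := word_hull_letter hx; exists (k, y).
  by have [k [z hz zy]] := word_hull_letter hy; exists (k, z).
pose z N := iter N (fun y => (f y).2) x.
have hz N : word_hull (z N) by elim: N => //= N IH; exact: (hf _ IH).1.
exists (fun N => (f (z N)).1) => // N _; exists (z N).
  exact: word_hull_sub.
elim: N => // N IH; rewrite mkseqS -cats1 comp_word_cat /= (hf _ (hz N)).2; exact: IH.
Qed.

End disc_words.

(** * Derivatives and images of word maps *)

Section disc_cifs.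
Context {R : realType} {I : countType}.
Variables (s : I -> plane R -> plane R) (a : I -> R) (rho : I -> plane R -> R).
Hypothesis sys : disc_system s a rho.
Variable S : cifs closed_disc s.
Let X : set (plane R) := closed_disc.
Let V := cifs_dom S.
Implicit Types (v w : seq I) (x y : plane R) (k : I).

Local Notation J := (limit_set closed_disc s).
Local Notation ext := (comp_word (cifs_extn S)).

Lemma ext_stable w x : V x -> V (ext w x).
Proof.
by move=> Vx; elim: w => //= k w IH; apply: (@cifs_stable _ _ _ _ S k);
  exists (ext w x).
Qed.

Lemma ext_eq w x : X x -> ext w x = comp_word s w x.
Proof.
move=> Xx; elim: w => //= k w ->; apply: cifs_ext.
by apply: word_stable Xx; exact: sys.
Qed.

Lemma ext_differentiable w x : V x -> differentiable (ext w) x.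
Proof.
move=> Vx; elim: w => [|k w IH]; first by case: (is_diff_id x).
apply: differentiable_comp => //.
have [e [_ _ /(_ k)[g [_ _ [dk _] _]]]] := cifs_diffeo S.
by apply: dk; exact: ext_stable.
Qed.

Lemma ext_conformal w x : V x -> exists2 l : R, 0 < l &
  forall z, enorm ('d (ext w) x z) = l * enorm z.
Proof.
move=> Vx; elim: w => [|k w [l l0 hl]].
  exists 1 => // z; rewrite mul1r.
  by have -> : 'd (ext [::]) x = id :> (plane R -> plane R) by case: (is_diff_id x).
have dk : differentiable (cifs_extn S k) (ext w x).
  by apply: (ext_differentiable [:: k]); exact: ext_stable.
have [l' l'0 hl'] := @cifs_conformal _ _ _ _ S k _ (ext_stable w Vx).
exists (l' * l); first exact: mulr_gt0.
move=> v; rewrite -mulrA -hl -hl'; congr (enorm _).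
exact: (congr1 (fun g => g v) (diff_comp (ext_differentiable w Vx) dk)).
Qed.

Lemma ext_continuous w x : V x -> {for x, continuous (ext w)}.
Proof. by move=> Vx; apply: differentiable_continuous; exact: ext_differentiable. Qed.

Lemma compact_disc : compact X.
Proof. by case: (cifs_ifs S). Qed.

Lemma compact_word_image w (C : set (plane R)) : closed C ->
  compact (comp_word s w @` (X `&` C)).
Proof.
move=> cC; have -> : comp_word s w @` (X `&` C) = ext w @` (X `&` C).
  by apply/seteqP; split => _ [x [Xx Cx] <-]; exists x => //; rewrite ext_eq.
apply: continuous_compact; last exact: compact_closedI compact_disc cC.
apply: continuous_in_subspaceT => x /set_mem[Xx _]; apply: ext_continuous.
exact: (@cifs_sub _ _ _ _ S).
Qed.

Lemma measurable_word_disc w : measurable (comp_word s w @` X).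
Proof.
rewrite -(setIT X); apply: compact_measurable_plane; apply: compact_word_image.
exact: closedT.
Qed.

(** By injectivity the image of the hull is again a countable intersection of countable unions of
    compact sets. *)
Lemma measurable_word_limit_set w : measurable (comp_word s w @` J).
Proof.
have -> : comp_word s w @` J = \bigcap_N
   \bigcup_(v in [set v : seq I | size v = N]) (comp_word s (w ++ v) @` X).
  rewrite (limit_set_hull sys); apply/seteqP; split => [_ [x hx <-] N _|y hy].
    have [v vN [z Xz <-]] := hx N Logic.I; exists v => //; exists z => //.
    by rewrite comp_word_cat.
  have [v0 _ [z0 Xz0 zy0]] := hy 0%N Logic.I.
  have Xx : X (comp_word s v0 z0) by apply: word_stable Xz0; exact: sys.
  exists (comp_word s v0 z0); last by rewrite -comp_word_cat.
  move=> N _; have [v vN [z Xz zy]] := hy N Logic.I; exists v => //; exists z => //.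
  apply: (word_inj sys (w := w)) => //; first by apply: word_stable Xz; exact: sys.
  by rewrite -!comp_word_cat zy.
apply: bigcapT_measurable => N; rewrite bigcup_mkcond.
apply: countable_bigcupT_measurable => [|v]; first exact: countableP.
by case: ifP => // _; exact: measurable_word_disc.
Qed.

Lemma measurable_limit_set : measurable J.
Proof. by have := measurable_word_limit_set [::]; rewrite image_id. Qed.

Lemma measurable_word_limit_set_closed w (C : set (plane R)) : closed C ->
  measurable (comp_word s w @` (J `&` C)).
Proof.
move=> cC; have -> : J `&` C = J `&` (X `&` C).
  by rewrite setIA (setIidl (limit_set_sub sys)).
rewrite (word_imageI sys); [|exact: (limit_set_sub sys)|exact: subIsetl].
apply: measurableI; first exact: measurable_word_limit_set.
by apply: compact_measurable_plane; exact: compact_word_image.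
Qed.

(** The direction points to the centre; at the centre itself any unit vector will do. *)
Lemma disc_direction x : X x -> exists2 v : plane R, v != 0 &
  forall t : R, 0 <= t -> t <= 1 -> X (t *: v + x).
Proof.
move=> Xx; have [->|x0] := eqVneq x 0.
  exists (1, 0);
    first by rewrite -enorm_eq0 /enorm /= expr1n expr0n /= addr0 sqrtr1 oner_eq0.
  move=> t t0 t1; rewrite addr0 /X /closed_disc /= enormZ ger0_norm//.
  by rewrite /enorm /= expr1n expr0n /= addr0 sqrtr1 mulr1.
exists (- x); first by rewrite oppr_eq0.
move=> t t0 t1; rewrite scalerN addrC -[X in X - _]scale1r -scalerBl.
rewrite /X /closed_disc /= enormZ ger0_norm; last lra.
by apply: mulr_ile1 => //; [lra|exact: enorm_ge0|lra].
Qed.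

(* The identity |f y - f z| = D(y) D(z) |y - z| makes D continuous, and read
   along a segment it identifies |f'| with D^2. *)
Lemma word_dnormE w x : X x -> word_dnorm S w x = mult s rho w x ^+ 2.
Proof.
move=> Xx; have Vx : V x by exact: (@cifs_sub _ _ _ _ S).
have [l l0 hl] := ext_conformal w Vx.
rewrite /word_dnorm /dnorm (opnorm_similarity (ltW l0) hl).
have [v v0 Xv] := disc_direction Xx.
have Xy : X (v + x) by rewrite -[v]scale1r; apply: Xv.
have v0' : 0 < enorm v by rewrite enorm_gt0.
pose D := mult s rho w; pose f := ext w.
have Dy0 : 0 < D (v + x) by exact: (mult_gt0 sys w Xy).
have lim1 := diff_quotient_cvg (v := v) (ext_differentiable w Vx).
rewrite hl in lim1.
(* By the two-point identity with the fixed point [v + x], the fraction equals [D (t *: v + x)] for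
   small nonnegative [t]; in this form continuity at 0 is visible. *)
pose u (t : R) := D x * enorm v * (enorm (f (t *: v + x) - f (v + x)) /
  (D (v + x) * enorm (t *: v + x - (v + x)))).
have tc : t *: v + x @[t --> (0 : R)] --> x.
  have {2}-> : x = 0 *: v + x by rewrite scale0r add0r.
  by apply: cvgD; [apply: cvgZ; [exact: cvg_id|exact: cvg_cst]|exact: cvg_cst].
have ec (y c : plane R) (g : R -> plane R) : g t @[t --> (0 : R)] --> y ->
    enorm (g t - c) @[t --> (0 : R)] --> enorm (y - c).
  by move=> gy;
    exact: (cvg_comp g (fun z => enorm (z - c)) gy (@continuous_enormB R c y)).
have lim2 : u t @[t --> (0 : R)] -->
    D x * enorm v * (enorm (f x - f (v + x)) / (D (v + x) * enorm (x - (v + x)))).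
  apply: cvgM; first exact: cvg_cst.
  apply: cvgM.
    by apply: ec; apply: (cvg_comp _ _ tc); exact: ext_continuous.
  apply: cvgV.
    by rewrite mulf_neq0 ?gt_eqF// opprD addrCA subrr addr0 enormN.
  apply: cvgM; first exact: cvg_cst.
  exact: ec tc.
have {lim2} lim2 :
  enorm (t^-1 *: (f (t *: v + x) - f x)) @[t --> 0^'+] --> D x ^+ 2 * enorm v.
  have -> : D x ^+ 2 * enorm v =
      D x * enorm v * (enorm (f x - f (v + x)) / (D (v + x) * enorm (x - (v + x)))).
    rewrite /f !ext_eq// (word_dist sys)// -/D; field.
    by rewrite opprD addrCA subrr addr0 enormN !gt_eqF.
  apply: cvg_trans (cvg_at_right_filter lim2); apply: near_eq_cvg.
  near=> t.
  have t0 : 0 < t by near: t; exact: nbhs_right_gt.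
  have t1 : t < 1 by near: t; apply: nbhs_right_lt.
  have Xt : X (t *: v + x) by apply: Xv; exact: ltW.
  rewrite /u /f !ext_eq// (word_dist sys)// enormZ (word_dist sys)// -/D.
  have -> : t *: v + x - x = t *: v by rewrite addrK.
  have e0 : 0 < enorm (t *: v + x - (v + x)).
    have -> : t *: v + x - (v + x) = (t - 1) *: v.
      by rewrite scalerBl scale1r opprD addrACA subrr addr0.
    by rewrite enormZ mulr_gt0// normr_gt0 subr_eq0 lt_eqF.
  rewrite enormZ normfV gtr0_norm//; field.
  by rewrite !gt_eqF.
have /mulIf : l * enorm v = D x ^+ 2 * enorm v.
  exact: cvg_unique lim1 lim2.
by apply; rewrite gt_eqF.
Unshelve. all: by end_near. Qed.

Lemma mult_distortion : exists2 K : R, 1 <= K & forall w x y, X x -> X y ->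
  mult s rho w y ^+ 2 <= K * mult s rho w x ^+ 2.
Proof.
have [K K1 hK] := cifs_distortion S; exists K => // -[|k w] x y Xx Xy.
  by rewrite /= !expr1n mulr1.
by rewrite -!word_dnormE//; apply: hK => //; exact: (@cifs_sub _ _ _ _ S).
Qed.

(** * Images of the open disc and the open set condition *)

Local Notation U w := (comp_word s w @` eball 0 1).

(** Each extension has a continuous inverse [g] on the open image of [V], so it carries open sets to
    open sets. *)
Lemma open_word_image w : open (U w).
Proof.
elim: w => [|k w IH]; first by rewrite image_id; exact: open_eball.
have UX : U w `<=` X.
  move=> _ [x /eball_sub_ecball + <-]; rewrite /ecball /= subr0 => x1.
  by apply: word_stable x1; exact: sys.
have -> : U (k :: w) = cifs_extn S k @` U w.
  apply/seteqP; split => [_ [x x1 <-]|_ [y [x x1 <-] <-]].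
    exists (comp_word s w x); first by exists x.
    by rewrite cifs_ext//; apply: UX; exists x.
  by exists x => //=; rewrite cifs_ext//; apply: UX; exists x.
have [e [_ _ /(_ k)[g [oV gK _ [dg _]]]]] := cifs_diffeo S.
have UV y : U w y -> V y by move/UX; exact: (@cifs_sub _ _ _ _ S).
rewrite openE => _ [y Uy <-].
have Vy : (cifs_extn S k @` V) (cifs_extn S k y) by exists y => //; exact: UV.
have n1 : nbhs (cifs_extn S k y) (cifs_extn S k @` V) by exact: open_nbhs_nbhs.
have n2 : nbhs (cifs_extn S k y) (g @^-1` U w).
  have := differentiable_continuous (dg _ Vy); apply.
  by rewrite gK; [exact: open_nbhs_nbhs|exact: UV].
rewrite /interior; near=> z.
have [u Vu uz] : (cifs_extn S k @` V) z by near: z.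
exists u => //; rewrite -(gK u)// uz; near: z; exact: n2.
Unshelve. all: by end_near. Qed.

Lemma word_image_sub_disc w : U w `<=` eball 0 1.
Proof.
move=> y Uy; rewrite -interior_closed_disc.
have : nbhs y (U w) by apply: open_nbhs_nbhs; split => //; exact: open_word_image.
apply: filterS => {Uy} _ [x /eball_sub_ecball + <-]; rewrite /ecball /= subr0 => x1.
by apply: word_stable x1; exact: sys.
Qed.

(** The code of such a point must begin with [w]: a different letter [j] would map interior points
    of the disc into the open image of letter [k], against the open set condition. *)
Lemma limit_set_word_image w : J `&` U w `<=` comp_word s w @` J.
Proof.
elim: w => [|k w IH]; first by move=> x [Jx _]; exists x.
move=> y [Jy [x x1 xy]]; have Uu : U w (comp_word s w x) by exists x.
have u1 := word_image_sub_disc Uu.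
have [j [z Jz zy]] := limit_set_letter sys Jy.
have Xz := limit_set_sub sys Jz.
have [jk|jk] := eqVneq j k.
  have uz : comp_word s w x = z.
    apply: (letter_inj sys (k := k)) => //.
      by apply: ltW; move: u1; rewrite /eball /= subr0.
    by rewrite -[in RHS]jk zy -xy.
  have [|p Jp pz] := IH z; first by split => //; rewrite -uz.
  by exists p => //=; rewrite pz -jk.
exfalso.
have oU : open (U [:: k]) by exact: open_word_image.
have Uky : nbhs y (U [:: k]).
  by apply: open_nbhs_nbhs; split => //; exists (comp_word s w x).
have Vz : V z by exact: (@cifs_sub _ _ _ _ S).
have nz : nbhs z (ext [:: j] @^-1` U [:: k]).
  apply: (ext_continuous (w := [:: j]) Vz).
  by rewrite ext_eq//= zy.
(* The point [z] may lie on the unit circle, so it is pulled slightly towards the centre. *)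
have [q [q1 qU]] : exists q, eball 0 1 q /\ U [:: k] (ext [:: j] q).
  have : (1 - t) *: z @[t --> (0 : R)] --> z.
    have {2}-> : z = (1 - 0) *: z by rewrite subr0 scale1r.
    apply: cvgZ; last exact: cvg_cst.
    by apply: cvgB; [exact: cvg_cst|exact: cvg_id].
  move=> /(_ _ nz) /= [e /= e0 he].
  pose t : R := Num.min (e / 2) (1 / 2).
  have t0 : 0 < t by rewrite lt_min; apply/andP; split; lra.
  have te : t <= e / 2 by rewrite ge_min lexx.
  have t1 : t <= 1 / 2 by rewrite ge_min lexx orbT.
  exists ((1 - t) *: z); split; last by apply: he;
    rewrite /= sub0r normrN gtr0_norm//; lra.
  rewrite /eball /= subr0 enormZ ger0_norm; last lra.
  apply: (@le_lt_trans _ _ (1 - t)); last lra.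
  by rewrite ler_piMr//; lra.
have qX : X q by move: q1; rewrite /eball /= subr0 => /ltW.
rewrite ext_eq//= in qU.
have := cifs_osc S (i := k) (j := j); rewrite interior_closed_disc => osc.
have /seteqP[/(_ (s j q)) + _] := osc (fun kj => negP jk (introT eqP (esym kj))).
by apply; split => //; exists q.
Qed.

(** The ball avoids the image of the unit circle, so the image of the open disc is both open and
    closed relative to the ball, which is connected. *)
Lemma eball_sub_word_image w x (r : R) : eball 0 1 x ->
  (forall z, enorm z = 1 -> r <= enorm (comp_word s w z - comp_word s w x)) ->
  eball (comp_word s w x) r `<=` U w.
Proof.
move=> x1 hr; have [r0|r0] := ltP 0 r; last first.
  by move=> y; rewrite /eball /= => /(le_lt_trans (enorm_ge0 _)); lra.
have BU : eball (comp_word s w x) r `&` U w =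
    eball (comp_word s w x) r `&` comp_word s w @` X.
  apply/seteqP; split => y [yr [z z1 zy]]; split => //; exists z => //.
    by move: z1; rewrite /eball /= subr0 => /ltW.
  rewrite /eball /= subr0 lt_neqAle; apply/andP; split => //.
  apply/eqP => /hr; rewrite zy; move: yr; rewrite /eball /=; lra.
suff : eball (comp_word s w x) r `&` U w = eball (comp_word s w x) r.
  by move=> <-; exact: subIsetr.
apply: connected_eball.
- exists (comp_word s w x); split; last by exists x.
  by rewrite /eball /= subrr enorm0.
- by exists (U w) => //; exact: open_word_image.
- exists (comp_word s w @` X) => //.
  rewrite -(setIT X); apply: compact_closed; first exact: norm_hausdorff.
  by apply: compact_word_image; exact: closedT.
Qed.

End disc_cifs.

(** * The conformal measure *)

Section measure_facts.
Context {d : measure_display} {T : measurableType d} {R : realType}.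
Variable mu : {measure set T -> \bar R}.
Local Open Scope ereal_scope.

(* Unlike [ge0_le_integral], no measurability of the integrands is needed, the
   integral of a nonnegative function being a supremum over simple functions. *)
Lemma ge0_le_integral_pointwise (A : set T) (f g : T -> \bar R) :
  (forall x, A x -> 0 <= f x) -> (forall x, A x -> f x <= g x) ->
  \int[mu]_(x in A) f x <= \int[mu]_(x in A) g x.
Proof.
move=> f0 fg; rewrite !ge0_integralE//; last first.
  by move=> x Ax; apply: le_trans (f0 _ Ax) (fg _ Ax).
apply: ereal_sup_le => _ [p /= pf <-]; exists p => //= x; apply: le_trans (pf x) _.
by rewrite !patchE; case: ifPn => // /set_mem; exact: fg.
Qed.

(** Null overlaps replace disjointness, as this is all that a conformal measure provides for
    cylinders. *)
Lemma measure_bigsetU_null (I : eqType) (F : I -> set T) (t : seq I) :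
  mu setT < +oo -> (forall k, measurable (F k)) -> uniq t ->
  (forall i j, i != j -> mu (F i `&` F j) = 0) ->
  mu (\big[setU/set0]_(k <- t) F k) = \sum_(k <- t) mu (F k).
Proof.
move=> muoo mF + F0; elim: t => [|k t IH]; first by rewrite !big_nil measure0.
move=> /= /andP[kt /IH {}IH]; rewrite !big_cons.
have mU (u : seq I) : measurable (\big[setU/set0]_(i <- u) F i).
  exact: bigsetU_measurable.
have null (u : seq I) : k \notin u -> mu (F k `&` \big[setU/set0]_(i <- u) F i) = 0.
  elim: u => [|i u IHu]; first by rewrite big_nil setI0 measure0.
  rewrite inE negb_or => /andP[ki /IHu u0]; rewrite big_cons setIUr measureU0//.
  - exact: F0.
  - by apply: measurableI.
  - by apply: measurableI.
rewrite measureUfinl// ?null// ?sube0 ?IH//.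
by apply: le_lt_trans muoo; apply: le_measure; rewrite ?inE.
Qed.

End measure_facts.

Lemma powR_ile1 (R : realType) (x t : R) : 0 <= t -> 0 <= x -> x <= 1 -> x `^ t <= 1.
Proof.
move=> t0 x0 x1; apply: (@le_trans _ _ (1 `^ t)); last by rewrite powR1.
by apply: ge0_ler_powR; rewrite ?nnegrE.
Qed.

(** Gives access to tails of series and countable subadditivity; indices coding no element
    contribute 0. *)
Lemma esum_pickle (R : realType) (I : countType) (f : I -> \bar R) :
  (forall k, 0 <= f k)%E ->
  (\esum_(k in [set: I]) f k = \sum_(0 <= n <oo) oapp f 0 (pickle_inv n))%E.
Proof.
move=> f0; rewrite nneseries_esumT; last by move=> n; case: pickle_inv.
have -> : (\esum_(n in [set: nat]) oapp f 0 (@pickle_inv I n) =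
    \esum_(n in pickle @` [set: I]) oapp f 0 (@pickle_inv I n))%E.
  rewrite [RHS]esum_mkcond; apply: eq_esum => n _; case: ifPn => // /negP nI.
  case kn : pickle_inv => [k|//]; exfalso; apply: nI; apply/mem_set; exists k => //.
  by have := @pickle_invK I n; rewrite kn.
rewrite esum_image; last by move=> i j _ _; exact: (pcan_inj pickleK_inv).
by apply: eq_esum => k _; rewrite pickleK_inv.
Qed.

Section conformal.
Context {R : realType} {I : countType}.
Variables (s : I -> plane R -> plane R) (a : I -> R) (rho : I -> plane R -> R).
Hypothesis sys : disc_system s a rho.
Variable S : cifs closed_disc s.
Variables (h : R) (m : probability (plane R) R).
Hypothesis conf : conformal_measure S h m.
Let X : set (plane R) := closed_disc.
Implicit Types (v w : seq I) (x y : plane R) (k : I) (A : set (plane R)).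

Local Notation J := (limit_set closed_disc s).
Local Notation D := (mult s rho).

Let h0 : 0 < h. Proof. by case: conf. Qed.

Let mJ : m J = 1%E. Proof. by case: conf. Qed.

Lemma measureI_limit_set A : measurable A -> m A = m (A `&` J).
Proof.
move=> mA; have mJm := measurable_limit_set sys S.
suff AJ0 : m (A `\` J) = 0%E.
  by rewrite -[RHS]add0e -AJ0; exact: measureDI.
apply: (subset_measure0 (B := ~` J)).
- exact: measurableD.
- exact: measurableC.
- by move=> x [].
- by have := probability_setC m mJm; rewrite mJ subee.
Qed.

Lemma conformal_le w A (c : R) : w != [::] -> measurable A -> A `<=` J ->
  (forall x, X x -> D w x ^+ 2 <= c) ->
  (m (comp_word s w @` A) <= (c `^ h)%:E * m A)%E.
Proof.
move=> w0 mA AJ Dc; have [_ _ _ + _] := conf.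
move/(_ w A) => ->//; last by rewrite lt0n size_eq0.
rewrite -integral_cst//; apply: ge0_le_integral_pointwise => x Ax.
  by rewrite lee_fin powR_ge0.
have Xx : X x by exact/(limit_set_sub sys)/AJ.
rewrite lee_fin (word_dnormE sys)//; apply: ge0_ler_powR;
  rewrite ?nnegrE ?sqr_ge0 ?(ltW h0) ?Dc//.
by apply: le_trans (Dc _ Xx); exact: sqr_ge0.
Qed.

Lemma conformal_ge w A (c : R) : w != [::] -> measurable A -> A `<=` J -> 0 <= c ->
  (forall x, X x -> c <= D w x ^+ 2) ->
  ((c `^ h)%:E * m A <= m (comp_word s w @` A))%E.
Proof.
move=> w0 mA AJ c0 Dc; have [_ _ _ + _] := conf.
move/(_ w A) => ->//; last by rewrite lt0n size_eq0.
rewrite -integral_cst//; apply: ge0_le_integral_pointwise => x Ax.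
  by rewrite lee_fin powR_ge0.
have Xx : X x by exact/(limit_set_sub sys)/AJ.
by rewrite lee_fin (word_dnormE sys)//; apply: ge0_ler_powR;
  rewrite ?nnegrE ?sqr_ge0 ?(ltW h0) ?Dc.
Qed.

(** If the sum diverges, then so does every partition sum of positive length, and the pressure at h
    / 2 is infinite. *)
Lemma summable_letters : (pressure S (h / 2) < +oo)%E ->
  (\esum_(k in [set: I]) ((a k + 1)^-1 `^ h)%:E < +oo)%E.
Proof.
rewrite !ltey; apply: contraNN => /eqP coo; apply/eqP.
have [k0 _] := disc_a_unbounded sys 0.
apply: lim_near_cst; first exact: ereal_hausdorff.
suff psoo N : partition_sum S N.+1 (h / 2) = +oo%E.
  exists 1%N => // -[//|N _] /=; rewrite psoo.
  by rewrite /= gt0_muley// lte_fin invr_gt0 ltr0n.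
(* Words with a free first letter followed by copies of [k0] suffice: each contributes at least p^h
   times the term of its first letter. *)
pose e k : N.+1.-tuple I := [tuple of k :: nseq N k0].
pose p := \prod_(k <- nseq N k0) (a k + 1)^-1.
have a1 k : 0 < (a k + 1)^-1 by rewrite invr_gt0; have := a_gt1 sys k; lra.
have p0 : 0 < p by apply: prodr_gt0.
apply/eqP; rewrite eq_le leey /=.
have -> : +oo%E = (\esum_(k in [set: I]) ((p `^ h)%:E * ((a k + 1)^-1 `^ h)%:E))%E.
  rewrite esum_pickle; last by move=> k; rewrite -EFinM lee_fin mulr_ge0 ?powR_ge0.
  rewrite (eq_eseriesr (g := fun n => ((p `^ h)%:E *
      oapp (fun k => ((a k + 1)^-1 `^ h)%:E) 0 (@pickle_inv I n))%E)); last first.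
    by move=> n _; case: pickle_inv => //=; rewrite mule0.
  rewrite nneseriesZl; last first.
    by move=> n _; case: pickle_inv => //= k; rewrite lee_fin powR_ge0.
  rewrite -esum_pickle; last by move=> k; rewrite lee_fin powR_ge0.
  by rewrite coo gt0_muley// lte_fin powR_gt0.
pose f (w : N.+1.-tuple I) := ereal_sup [set (word_dnorm S w x `^ (h / 2))%:E | x in X].
have X0 : X 0 by exact: closed_disc0.
have f0 (w : N.+1.-tuple I) : (((\prod_(k <- w) (a k + 1)^-1) `^ h)%:E <= f w)%E.
  apply: le_trans (ereal_sup_ubound _); last by exists 0.
  rewrite lee_fin (word_dnormE sys)//.
  have /andP[D1 _] := mult_bounds sys w X0.
  have D0 := ltW (mult_gt0 sys w X0).
  (* The derivative norm is the square of [mult], so the exponent h / 2 becomes h. *)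
  rewrite -powR_mulrn// -powRrM mulrCA mulfV ?mulr1; last by rewrite pnatr_eq0.
  apply: ge0_ler_powR; rewrite ?nnegrE ?(ltW h0)//.
  by apply: prodr_ge0 => k _; exact/ltW/a1.
have f0' (w : N.+1.-tuple I) : (0 <= f w)%E by apply: le_trans (f0 w);
  rewrite lee_fin powR_ge0.
apply: (@le_trans _ _ (\esum_(k in [set: I]) f (e k))%E).
  apply: le_esum => k _; apply: le_trans (f0 _).
  rewrite -EFinM lee_fin big_cons -powRM ?(ltW p0) ?(ltW (a1 _))//.
  by rewrite mulrC.
rewrite -(esum_image [set: I] e f); last first.
  by move=> i j _ _ /(congr1 val) [].
rewrite esum_mkcond; apply: le_esum => w _; case: ifP => // _; exact: f0'.
Qed.

Lemma thin_at_0 : (pressure S (h / 2) < +oo)%E ->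
  forall e : R, 0 < e -> exists2 r0 : R, 0 < r0 & forall r, 0 < r -> r < r0 ->
     (m (eball 0%R r) <= (e * r `^ h)%:E)%E.
Proof.
move=> /summable_letters + e e0.
rewrite esum_pickle; last by move=> k; rewrite lee_fin powR_ge0.
pose c n := oapp (fun k => ((a k + 1)^-1 `^ h)%:E) 0%E (@pickle_inv I n).
move=> sum_oo; have {sum_oo} c_oo : (\sum_(0 <= n <oo) c n < +oo)%E by exact: sum_oo.
have c0 n : (0 <= c n)%E by rewrite /c; case: pickle_inv => //= k;
  rewrite lee_fin powR_ge0.
have p9 : 0 < (9 : R) `^ h by rewrite powR_gt0.
have [N tailN] : exists N, (\sum_(N <= n <oo) c n <= (e / 9 `^ h)%:E)%E.
  have /fine_cvgP[fN /cvgrPdist_lt /(_ _ (divr_gt0 e0 p9)) cN] :=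
    nneseries_tail_cvg c_oo (fun n _ => c0 n).
  near \oo => N; exists N.
  have fin : (\sum_(N <= n <oo) c n \is a fin_num)%E by near: N.
  rewrite -(fineK fin) lee_fin; apply: ltW; apply: le_lt_trans (ler_norm _) _.
  by rewrite -normrN -sub0r; near: N.
(* Images of letter [k] stay at distance at least 1/(a k + 1) from 0, so a ball of radius below [r0]
   misses the letters with index below [N]. *)
have [r0 r00 hr0] : exists2 r0 : R, 0 < r0 & forall n k, (n < N)%N ->
    pickle_inv n = Some k -> r0 <= (a k + 1)^-1.
  elim: N {tailN} => [|N [r0 r00 IH]]; first by exists 1.
  case NE : (@pickle_inv I N) => [k|]; last first.
    by exists r0 => // n j; rewrite ltnS leq_eqVlt => /predU1P[-> /[!NE]//|nj];
      exact: IH.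
  exists (Num.min r0 (a k + 1)^-1).
    by rewrite lt_min r00 invr_gt0; have := a_gt1 sys k; lra.
  move=> n j; rewrite ltnS leq_eqVlt => /predU1P[->|/IH nj].
    by rewrite NE => -[<-]; rewrite ge_min lexx orbT.
  by move=> /nj rj; rewrite ge_min rj.
exists r0 => // r rp rr0.
pose F n := oapp (fun k => if (a k + 1)^-1 < r then s k @` J else set0) set0
  (@pickle_inv I n).
have mF n : measurable (F n).
  rewrite /F; case: pickle_inv => //= k; case: ifP => // _.
  exact: (measurable_word_limit_set sys S [:: k]).
have mE : measurable (eball 0 r : set (plane R)).
  by apply: open_measurable_plane; exact: open_eball.
rewrite measureI_limit_set//.
apply: (@le_trans _ _ (\sum_(0 <= n <oo) m (F n))%E).
  apply: measure_sigma_subadditive => //.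
    by apply: measurableI => //; exact: (measurable_limit_set sys S).
  move=> y [y_r /(limit_set_letter sys)[k [z Jz zy]]].
  exists (pickle k) => //; rewrite /F pickleK_inv /= ifT; first by exists z.
  have /andP[+ _] := disc_image_bounds sys k (limit_set_sub sys Jz).
  by rewrite zy => /le_lt_trans; apply; move: y_r; rewrite /eball /= subr0.
rewrite (nneseries_split 0 N)// big1_seq ?add0e; last first.
  move=> n /andP[_]; rewrite add0n mem_index_iota => /andP[_ nN].
  rewrite /F; case nk : pickle_inv => [k|] /=; last exact: measure0.
  rewrite ifF ?measure0//; apply/negbTE; rewrite -leNgt.
  by apply: le_trans (ltW rr0) _; exact: hr0 nk.
(* One of the two factors 1/(a k + 1) in the derivative bound is below [r]; the other remains as the
   term of the convergent series. *)
apply: (@le_trans _ _ (\sum_(N <= n <oo) (((9 * r) `^ h)%:E * c n))%E).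
  apply: lee_nneseries => // n _; rewrite /F /c.
  case: pickle_inv => [k|] /=; last by rewrite measure0 mule0.
  have a2 := disc_a_ge2 sys k.
  case: ifPn => [ar|_]; last first.
    by rewrite measure0 -EFinM lee_fin mulr_ge0 ?powR_ge0.
  have mJm := measurable_limit_set sys S.
  have /(_ [:: k] J (9 * r * (a k + 1)^-1)) := conformal_le.
  rewrite mJ mule1 => /(_ isT mJm (fun _ => id)) hk.
  rewrite -EFinM -powRM ?mulr_ge0 ?(ltW rp)//; last by rewrite invr_ge0; lra.
  apply: hk => x Xx /=; rewrite mulr1.
  have /andP[l1 l2] := disc_rho_bounds sys k Xx.
  have b0 : 0 < (a k + 1)^-1 by rewrite invr_gt0; lra.
  (* From [2 <= a k] follows [a k + 1 <= 3 * (a k - 1)]; squaring this 3 yields the constant 9. *)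
  have b3 : (a k - 1)^-1 <= 3 * (a k + 1)^-1.
    rewrite -[leLHS]mul1r ler_pdivrMr; last lra.
    rewrite mulrAC ler_pdivlMr; lra.
  apply: (@le_trans _ _ ((3 * (a k + 1)^-1) ^+ 2)).
    by rewrite lerXn2r ?nnegrE ?(le_trans l2 b3)//; [exact: le_trans (ltW b0) l1|lra].
  have -> : (3 * (a k + 1)^-1) ^+ 2 = 9 * (a k + 1)^-1 * (a k + 1)^-1 by ring.
  by rewrite ler_pM2r// ler_pM2l// ltW.
rewrite nneseriesZl//.
apply: le_trans (lee_wpmul2l _ tailN) _; first by rewrite lee_fin powR_ge0.
rewrite -EFinM lee_fin powRM ?(ltW rp)//.
by rewrite mulrC -mulrA [X in _ * X]mulrA mulVf ?gt_eqF// mul1r.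
Unshelve. all: by end_near. Qed.

(** * Bounded distortion and points with confined codes *)

Variable K : R.
Hypothesis K1 : 1 <= K.
Hypothesis distortion : forall w x y, X x -> X y ->
  mult s rho w y ^+ 2 <= K * mult s rho w x ^+ 2.

Local Notation lam w := (D w 0 ^+ 2).

(** Distortion replaces the integrand by its value at 0 at the cost of a factor [K]; since [K] is at
    least 1 the empty word is included. *)
Lemma word_measure_le w A : measurable A -> A `<=` J ->
  (m (comp_word s w @` A) <= ((K * lam w) `^ h)%:E * m A)%E.
Proof.
move=> mA AJ; have [->|w0] := eqVneq w [::].
  rewrite image_id -[leLHS]mul1e; apply: lee_wpmul2r => //.
  rewrite lee_fin /= expr1n mulr1 -[leLHS](powRr0 K); apply: ler_powR => //.
  exact: ltW.
apply: conformal_le => // x Xx; apply: distortion => //; exact: closed_disc0.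
Qed.

Lemma word_measure_ge w A : measurable A -> A `<=` J ->
  (((lam w / K) `^ h)%:E * m A <= m (comp_word s w @` A))%E.
Proof.
have K0 : 0 < K := lt_le_trans ltr01 K1.
move=> mA AJ; have [->|w0] := eqVneq w [::].
  rewrite image_id -[leRHS]mul1e; apply: lee_wpmul2r => //.
  rewrite lee_fin /= expr1n mul1r; apply: powR_ile1.
  - exact: ltW.
  - by rewrite invr_ge0 ltW.
  - by rewrite invf_le1.
apply: conformal_ge => //; first by rewrite divr_ge0 ?sqr_ge0 ?ltW.
by move=> x Xx; rewrite ler_pdivrMr// mulrC; apply: distortion => //;
  exact: closed_disc0.
Qed.

Lemma rcons_image w k A : comp_word s (rcons w k) @` A = comp_word s w @` (s k @` A).
Proof.
apply/seteqP; split => [_ [x Ax <-]|_ [_ [x Ax <-] <-]]; rewrite -cats1.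
  by rewrite comp_word_cat; exists (s k x) => //; exists x.
by exists x => //; rewrite comp_word_cat.
Qed.

(** By injectivity the overlap is the word image of a null first-level overlap, and word images of
    null sets are null. *)
Lemma letters_null w i j : i != j ->
  m ((comp_word s (rcons w i) @` J) `&` (comp_word s (rcons w j) @` J)) = 0%E.
Proof.
move=> ij; have mw v : measurable (comp_word s v @` J).
  exact: (measurable_word_limit_set sys S).
have kJ k : s k @` J `<=` J by exact: (letter_limit_set sys).
have JX := limit_set_sub sys.
rewrite !rcons_image -(word_imageI sys); [|by move=> x /kJ/JX|by move=> x /kJ/JX].
have mk k : measurable (s k @` J) by exact: (mw [:: k]).
have null : m (s i @` J `&` s j @` J) = 0%E.
  have [_ _ _ _ /(_ i j) ov] := conf.
  apply: (subset_measure0 (B := s i @` X `&` s j @` X)).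
  - exact: measurableI.
  - by apply: measurableI; exact: (measurable_word_disc sys S [:: _]).
  - by apply: setISS; apply: image_subset; exact: JX.
  - by apply: ov; exact/eqP.
apply/eqP; rewrite eq_le measure_ge0 andbT.
apply: le_trans (word_measure_le _ _ _) _; [exact: measurableI|by move=> x [/kJ]|].
by rewrite null mule0.
Qed.

Lemma letters_sum_le w (t : seq I) : uniq t ->
  (\sum_(k <- t) m (comp_word s (rcons w k) @` J) <= m (comp_word s w @` J))%E.
Proof.
move=> ut; rewrite -measure_bigsetU_null//; last 3 first.
- by apply: le_lt_trans (probability_le1 m measurableT) _; rewrite ltry.
- by move=> k; exact: (measurable_word_limit_set sys S).
- by move=> i j; exact: letters_null.
apply: le_measure; rewrite ?inE.
- by apply: bigsetU_measurable => k _; exact: (measurable_word_limit_set sys S).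
- exact: (measurable_word_limit_set sys S).
- rewrite -bigcup_seq => _ [k _ [x Jx <-]]; rewrite -cats1 comp_word_cat.
  by exists (s k x) => //; apply: (letter_limit_set sys); exists x.
Qed.

(** Only the first [n] letters are restricted to [t]; the rest of the code is free. *)
Fixpoint confined (t : seq I) n : set (plane R) :=
  if n is n'.+1 then \bigcup_(k in [set` t]) (s k @` confined t n') else J.

Lemma word_confined t n w : comp_word s w @` confined t n.+1 =
  \big[setU/set0]_(k <- t) (comp_word s (rcons w k) @` confined t n).
Proof.
rewrite /= image_bigcup -bigcup_seq; apply: eq_bigcupr => k _.
by rewrite rcons_image.
Qed.

Lemma measurable_word_confined t n w : measurable (comp_word s w @` confined t n).
Proof.
elim: n w => [|n IH] w; first exact: (measurable_word_limit_set sys S).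
by rewrite word_confined; apply: bigsetU_measurable => k _; exact: IH.
Qed.

Lemma letter_measure_gt0 k : (0 < m (s k @` J))%E.
Proof.
have p0 : 0 < (a k + 1)^-1 by rewrite invr_gt0; have := disc_a_ge2 sys k; lra.
have /(_ [:: k] J ((a k + 1)^-1 ^+ 2)) := conformal_ge; rewrite mJ mule1 => hk.
apply: lt_le_trans (hk _ _ _ _ _) => //.
- by rewrite lte_fin powR_gt0// exprn_gt0.
- exact: (measurable_limit_set sys S).
- exact: sqr_ge0.
- move=> x Xx /=; rewrite mulr1 lerXn2r ?nnegrE ?(ltW p0)//.
    by apply: le_trans (ltW p0) _; case/andP: (disc_rho_bounds sys k Xx).
  by case/andP: (disc_rho_bounds sys k Xx).
Qed.

(** Inside every cylinder the omitted letter [k0] takes at least the proportion [q], so each further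
    restricted letter costs a factor 1 - q. *)
Lemma confined_decay t k0 : uniq t -> k0 \notin t ->
  exists2 q : R, 0 < q <= 1 & forall n w,
    (m (comp_word s w @` confined t n) <= ((1 - q) ^+ n)%:E * m (comp_word s w @` J))%E.
Proof.
move=> ut k0t; have K0 : 0 < K := lt_le_trans ltr01 K1.
have mw v : measurable (comp_word s v @` J).
  exact: (measurable_word_limit_set sys S).
have fw v : m (comp_word s v @` J) = (fine (m (comp_word s v @` J)))%:E.
  by rewrite fineK// fin_num_measure.
pose p := fine (m (s k0 @` J)).
have fp : m (s k0 @` J) = p%:E by exact: (fw [:: k0]).
have p0 : 0 < p by have := letter_measure_gt0 k0; rewrite fp lte_fin.
have p1 : p <= 1 by rewrite -lee_fin -fp; apply: probability_le1; exact: (mw [:: k0]).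
(* One factor [K] is lost in bounding the cylinder of [w] from above, the other in bounding that of
   [rcons w k0] from below. *)
pose q := (K ^+ 2)^-1 `^ h * p.
have q01 : 0 < q <= 1.
  apply/andP; split; first by rewrite mulr_gt0// powR_gt0// invr_gt0 exprn_gt0.
  apply: mulr_ile1; rewrite ?powR_ge0 ?(ltW p0)//.
  apply: powR_ile1; first exact: ltW.
    by rewrite invr_ge0 sqr_ge0.
  by rewrite invf_le1 ?exprn_gt0// exprn_ege1.
exists q => //; elim=> [|n IH] w; first by rewrite expr0 mul1e.
have q1 : 0 <= 1 - q by lra.
have kw : q * fine (m (comp_word s w @` J)) <= fine (m (comp_word s (rcons w k0) @` J)).
  rewrite -lee_fin EFinM -!fw.
  rewrite rcons_image.
  apply: le_trans (word_measure_ge _ _ _); last 2 first.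
  - exact: (mw [:: k0]).
  - exact: (letter_limit_set sys).
  rewrite fp -EFinM.
  have := @word_measure_le w J (measurable_limit_set sys S) (fun _ => id).
  rewrite mJ mule1 => hwJ.
  have q0 : (0%:E <= q%:E)%E by rewrite lee_fin; case/andP: q01 => /ltW.
  apply: le_trans (lee_wpmul2l q0 hwJ) _.
  have Kl0 : 0 <= K * D w 0 ^+ 2 by rewrite mulr_ge0 ?sqr_ge0// ltW.
  rewrite -EFinM lee_fin /q mulrAC ler_pM2r// -powRM// ?invr_ge0 ?sqr_ge0//.
  have -> : (K ^+ 2)^-1 * (K * D w 0 ^+ 2) = D w 0 ^+ 2 / K by field; rewrite gt_eqF.
  by [].
rewrite word_confined.
have subadd (u : seq I) :
  (m (\big[setU/set0]_(k <- u) (comp_word s (rcons w k) @` confined t n))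
     <= \sum_(k <- u) m (comp_word s (rcons w k) @` confined t n))%E.
  elim: u => [|k u IHu]; first by rewrite !big_nil measure0.
  rewrite !big_cons; apply: le_trans (leeD (le_refl _) IHu); apply: measureU2.
    exact: measurable_word_confined.
  by apply: bigsetU_measurable => i _; exact: measurable_word_confined.
apply: le_trans (subadd t) _.
apply: (@le_trans _ _ (\sum_(k <- t) ((1 - q) ^+ n)%:E * m (comp_word s (rcons w k) @` J)))%E.
  by apply: lee_sum => k _; exact: IH.
rewrite -ge0_sume_distrr//.
rewrite exprS mulrC EFinM -muleA; apply: lee_wpmul2l;
  first by rewrite lee_fin exprn_ge0.
have := letters_sum_le w (t := k0 :: t); rewrite /= k0t => /(_ ut).
rewrite big_cons; under eq_bigr do rewrite fw.
rewrite sumEFin (fw (rcons w k0)) (fw w) -EFinD -EFinM !lee_fin; lra.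
Qed.

Lemma confined_null t k0 : uniq t -> k0 \notin t ->
  m.-negligible (\bigcap_n confined t n).
Proof.
move=> ut k0t; have [q /andP[q0 q1] hq] := confined_decay ut k0t.
have mc n : measurable (confined t n).
  by have := measurable_word_confined t n [::]; rewrite image_id.
have mI : measurable (\bigcap_n confined t n) by exact: bigcapT_measurable.
exists (\bigcap_n confined t n); split => //.
apply/eqP; rewrite eq_le measure_ge0 andbT.
have qn : (1 - q) ^+ n @[n --> \oo] --> (0 : R).
  by apply: cvg_expr; rewrite ger0_norm; lra.
have qn' : ((1 - q) ^+ n)%:E @[n --> \oo] --> (0 : \bar R)%E.
  by apply/fine_cvgP; split => //; exact: nearW.
apply: (cvge_ge _ qn'); apply: nearW => n.
have := hq n [::]; rewrite !image_id mJ mule1; apply: le_trans.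
by apply: le_measure; rewrite ?inE// => x; apply.
Qed.

(** For large [M] the point [s k z] lies within 1/(M - 1) of the origin, so [x] is a word image of a
    point close to 0. *)
Definition recurrent (M : R) : set (plane R) :=
  [set x | exists w k z, [/\ M < a k, J z & x = comp_word s w (s k z)]].

(** A point failing this for some [n] has a code using only the finitely many letters with [a k] at
    most [n]; as another letter exists, such points form a null set. *)
Lemma recurrent_ae : m.-negligible (J `\` \bigcap_n recurrent n%:R).
Proof.
apply: (@negligibleS _ _ _ m (\bigcup_n (J `\` recurrent n%:R))).
  move=> x [Jx /existsNP[n /not_implyP[_ nx]]]; by exists n.
apply: negligible_bigcup => n.
have /finite_seqP[t0 ht0] := disc_a_finite sys (n%:R : R).
pose t := undup t0.
have tE k : (k \in t) = (a k <= n%:R).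
  apply/idP/idP; rewrite mem_undup => kt; last by suff : [set` t0] k by [];
    rewrite -ht0.
  by have : [set` t0] k by []; rewrite -ht0.
have [k0 hk0] := disc_a_unbounded sys (n%:R : R).
apply: (@negligibleS _ _ _ m (\bigcap_n confined t n)); last first.
  apply: (@confined_null t k0); first exact: undup_uniq.
  by rewrite tE -ltNge.
move=> x [/(limit_set_coded sys)[omega xo] nrec] N _.
have ot i : omega i \in t.
  rewrite tE leNgt; apply/negP => ai; apply: nrec.
  have [z Jz <-] := xo i.+1; exists (mkseq omega i), (omega i), z; split => //.
  by rewrite mkseqS -cats1 comp_word_cat.
have cw w z : J z -> {subset w <= t} -> confined t (size w) (comp_word s w z).
  move=> Jz; elim: w => [//|k w IH] kw /=; exists k; first by apply: kw;
    exact: mem_head.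
  exists (comp_word s w z) => //; apply: IH => i iw; apply: kw.
  by rewrite inE iw orbT.
have [z Jz <-] := xo N; rewrite -{1}(size_mkseq omega N); apply: cw => // i.
by move=> /mapP[j _ ->].
Qed.

(** A small ball around [x] pulls back under [s_w] into a ball around 0. The radius scales by [l],
    the derivative norm at 0, and the mass by its h-th power, both up to powers of [K]. *)
Lemma thin_at_recurrent :
  (forall e : R, 0 < e -> exists2 r0 : R, 0 < r0 & forall r, 0 < r -> r < r0 ->
     (m (eball 0%R r) <= (e * r `^ h)%:E)%E) ->
  forall x, (\bigcap_n recurrent n%:R) x ->
  forall e delta : R, 0 < e -> 0 < delta ->
  exists r : R, [/\ 0 < r, r <= delta & (m (ecball x (3 * r)) <= (e * r `^ h)%:E)%E].
Proof.
move=> thin0 x rec e delta e0 delta0; have K0 : 0 < K := lt_le_trans ltr01 K1.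
(* The term 3 comes from the ball around [x], the term [K] from the distance of [x] to the image of
   0, and the outer [K] from pulling back. *)
have [B BE] : exists B, B = K * (3 + K) by exists (K * (3 + K)).
have B0 : 0 < B by rewrite BE mulr_gt0//; lra.
(* Collects the constants of the final estimate, so that thinness [e / C] at 0 becomes thinness [e]
   at [x]. *)
pose C := (K * (2 * B)) `^ h.
have C0 : 0 < C by apply: powR_gt0; apply: mulr_gt0 => //; exact: mulr_gt0.
have [r0 r00 hr0] := thin0 (e / C) (divr_gt0 e0 C0).
have B2 : 0 < 2 * B by exact: mulr_gt0.
have B4 : 0 < 4 * B by exact: mulr_gt0.
(* The three bounds respect [delta], keep the ball inside the image of the open disc, and bring the
   radius [2 * B * r1] below [r0]. *)
pose r1 := Num.min delta (Num.min (2 * B)^-1 (r0 / (4 * B))).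
have r1delta : r1 <= delta by rewrite ge_min lexx.
have r1B : r1 <= (2 * B)^-1 by rewrite !ge_min lexx !orbT.
have r1r0 : r1 <= r0 / (4 * B) by rewrite !ge_min lexx !orbT.
have r10 : 0 < r1 by rewrite !lt_min delta0 invr_gt0 B2 divr_gt0.
have Br1 : B * r1 <= 1 / 2.
  apply: (@le_trans _ _ (B * (2 * B)^-1)); first by rewrite ler_pM2l.
  by rewrite invfM mulrCA mulfV ?gt_eqF// mulr1 div1r.
have Br0 : 2 * B * r1 < r0.
  apply: (@le_lt_trans _ _ (2 * B * (r0 / (4 * B))));
    first by rewrite ler_pM2l ?mulr_gt0.
  have -> : 2 * B * (r0 / (4 * B)) = r0 / 2 by field; rewrite gt_eqF.
  lra.
(* Forces [a k] above 1/r1 + 1, which places [s k z'] within [r1] of 0. *)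
pose n := (Num.truncn (r1^-1 + 1)).+1.
have [w [k [z' [ak Jz' xE]]]] := rec n Logic.I.
have {ak} ak : r1^-1 + 1 < a k by apply: lt_trans ak; exact: truncnS_gt.
set z := s k z' in xE.
have X0 : X 0 by exact: closed_disc0.
have Xz' : X z' by exact: (limit_set_sub sys).
have Xz : X z by exact: (letter_stable sys).
have zr : enorm z <= r1.
  have /andP[_ /le_trans] := disc_image_bounds sys k Xz'; apply.
  by rewrite -[leRHS]invrK lef_pV2 ?posrE ?invr_gt0//; have := invr_gt0 r1;
    rewrite r10; lra.
have D0 y : X y -> 0 < D w y by exact: (mult_gt0 sys).
have Dn y : X y -> 0 <= D w y by move=> Xy; exact/ltW/D0.
have KD y : X y -> 0 <= K * D w y by move=> Xy; rewrite mulr_ge0 ?Dn// ltW.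
have Dup y : X y -> D w y <= K * D w 0.
  move=> Xy; rewrite -(@ler_pXn2r _ 2) ?nnegrE ?KD ?Dn//.
  apply: le_trans (distortion w X0 Xy) _; rewrite exprMn ler_pM2r ?exprn_gt0 ?D0//.
  by rewrite expr2 ler_peMl// ltW.
have Dlo y : X y -> D w 0 / K <= D w y.
  move=> Xy; rewrite ler_pdivrMr// mulrC.
  rewrite -(@ler_pXn2r _ 2) ?nnegrE ?KD ?Dn//.
  apply: le_trans (distortion w Xy X0) _; rewrite exprMn ler_pM2r ?exprn_gt0 ?D0//.
  by rewrite expr2 ler_peMl// ltW.
pose l := D w 0 ^+ 2; have l0 : 0 < l by rewrite exprn_gt0 ?D0.
have l1 : l <= 1 by rewrite exprn_ile1 ?(ltW (D0 _ X0))// (mult_le1 sys).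
have xw0 : enorm (x - comp_word s w 0) <= K * l * r1.
  rewrite xE (word_dist sys)// subr0 ler_pM ?enorm_ge0// ?mulr_ge0 ?Dn//.
  by rewrite /l expr2 mulrA ler_pM2r ?D0// Dup.
have low u : X u -> l / K * enorm u <= enorm (comp_word s w u - comp_word s w 0).
  move=> Xu; rewrite (word_dist sys)// subr0; apply: ler_wpM2r; first exact: enorm_ge0.
  have -> : l / K = D w 0 / K * D w 0 by rewrite /l; field; rewrite gt_eqF.
  by apply: ler_wpM2r; [exact/ltW/D0|exact: Dlo].
exists (l * r1); split; first exact: mulr_gt0.
  by apply: le_trans r1delta; rewrite ler_piMl// ltW.
have mB y (r : R) : measurable (ecball y r).
  by apply: closed_measurable_plane; exact: closed_ecball.
rewrite measureI_limit_set//.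
pose A := J `&` ecball 0 (B * r1).
have mA : measurable A by apply: measurableI => //; exact: (measurable_limit_set sys S).
(* The ball lies in the image of the open disc, so its limit points have preimages in [J]; the lower
   distortion bound puts these within [B * r1] of 0. *)
have sub : ecball x (3 * (l * r1)) `&` J `<=` comp_word s w @` A.
  move=> y [xy Jy]; rewrite /ecball /= in xy.
  have yw0 : enorm (y - comp_word s w 0) <= (3 + K) * r1 * l.
    by have := enorm_triangle x y (comp_word s w 0); lra.
  have [u Ju uy] : (comp_word s w @` J) y.
    apply: (limit_set_word_image sys S); split => //;
      apply: (eball_sub_word_image sys S (x := 0) (r := l / K)) => //.
    - by rewrite /eball /= subrr enorm0.
    - by move=> u u1; have := low u; rewrite u1 mulr1; apply;
        rewrite /X /closed_disc /= u1.
    - rewrite /eball /=; apply: le_lt_trans yw0 _.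
      rewrite ltr_pdivlMr// (_ : _ * K = B * r1 * l); last by rewrite BE; ring.
      by rewrite gtr_pMl//; lra.
  exists u => //; split => //; have Xu := limit_set_sub sys Ju.
  rewrite /ecball /= subr0; have := low u Xu; rewrite uy => /le_trans/(_ yw0).
  rewrite mulrAC ler_pdivrMr// (_ : _ * K = l * (B * r1)); last by rewrite BE; ring.
  by rewrite ler_pM2l.
apply: (@le_trans _ _ (m (comp_word s w @` A))).
  apply: le_measure; rewrite ?inE//.
    by apply: measurableI => //; exact: (measurable_limit_set sys S).
  by apply: (measurable_word_limit_set_closed sys S); exact: closed_ecball.
apply: le_trans (word_measure_le _ _ _) _ => //; first exact: subIsetl.
have mAr : (m A <= (e / C * (2 * B * r1) `^ h)%:E)%E.
  apply: le_trans (hr0 _ _ Br0); last by rewrite !mulr_gt0.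
  apply: le_measure; rewrite ?inE//.
    by apply: open_measurable_plane; exact: open_eball.
  move=> y [_]; apply: sub_ecball_eball.
  by rewrite ltr_pM2r// ltr_pMl//; lra.
apply: le_trans (lee_wpmul2l _ mAr) _; first by rewrite lee_fin powR_ge0.
rewrite -EFinM lee_fin -/l.
have -> : (K * l) `^ h * (e / C * (2 * B * r1) `^ h) =
    e / C * ((K * l) `^ h * (2 * B * r1) `^ h) by ring.
have p1 : 0 <= K * l by exact/ltW/mulr_gt0.
have p2 : 0 <= 2 * B * r1 by exact/ltW/mulr_gt0.
have p3 : 0 <= K * (2 * B) by exact/ltW/mulr_gt0.
have p4 : 0 <= l * r1 by exact/ltW/mulr_gt0.
rewrite -powRM// (_ : K * l * (2 * B * r1) = K * (2 * B) * (l * r1)); last by ring.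
by rewrite (powRM _ p3 p4) -/C mulrA divfK ?gt_eqF.
Qed.

End conformal.

(** Joins thinness at 0, its transport to almost every point of the limit set, and the packing
    criterion. *)
Lemma disc_cifs_thin (R : realType) (I : countType) (s : I -> plane R -> plane R)
    (a : I -> R) (rho : I -> plane R -> R) (sys : disc_system s a rho)
    (S : cifs closed_disc s) (h : R) (m : probability (plane R) R) :
  conformal_measure S h m -> (pressure S (h / 2) < +oo)%E ->
  limf_esup (fun r : R => (m (eball 0%R r) * ((r `^ h)^-1)%:E)%E) (0 : R)^'+ = 0%E
  /\ packing_measure h (limit_set closed_disc s) = +oo%E.
Proof.
move=> conf P.
have [K K1 dist] := mult_distortion sys S.
have thin0 := thin_at_0 sys conf P.
split.
  apply/eqP; rewrite eq_le; apply/andP; split; last first.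
    apply: limf_esup_ge0; first exact: filter_not_empty.
    by move=> r; rewrite mule_ge0// lee_fin invr_ge0 powR_ge0.
  apply/lee_addgt0Pr => e e0; rewrite add0e.
  have [r0 r00 hr0] := thin0 e e0.
  (* The limit superior is an infimum of suprema over right neighbourhoods of 0; the interval from 0
     to [r0] is enough. *)
  apply: ereal_inf_le; exists (ereal_sup [set (m (eball 0%R r) * ((r `^ h)^-1)%:E)%E
      | r in [set r : R | 0 < r < r0]]).
    exists [set r : R | 0 < r < r0] => //.
    near=> r; apply/andP; split; near: r; [exact: nbhs_right_gt|exact: nbhs_right_lt].
  apply: ge_ereal_sup => _ [r /andP[rp rr0] <-].
  have rh : 0 < r `^ h by rewrite powR_gt0.
  apply: le_trans (lee_wpmul2r _ (hr0 r rp rr0)) _;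
    first by rewrite lee_fin invr_ge0 ltW.
  by rewrite -EFinM lee_fin mulfK// gt_eqF.
have [h0 _ mJ _ _] := conf.
apply: (packing_measure_pinfty (m := m) (ltW h0) (measurable_limit_set sys S) mJ
  (recurrent_ae sys conf K1 dist)).
move=> z [Jz /not_andP[//|/contrapT rec]] e delta e0 delta0.
exact: (thin_at_recurrent sys conf K1 dist thin0 rec).
Unshelve. all: by end_near. Qed.

(** * The systems F and G *)

Section systems.
Context {R : realType}.
Implicit Types (z w : R[i]) (x y : plane R) (r : R).

(** A real-valued modulus; the norm on [R[i]] takes its values in [R[i]]. *)
Definition cabs w : R := enorm (ofC w).

Lemma cabsE w : (cabs w)%:C%C = `|w|.
Proof. by case: w. Qed.

Lemma cabs_inj w r : `|w| = r%:C%C -> cabs w = r.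
Proof. by rewrite -cabsE => -[]. Qed.

Lemma cabsM z w : cabs (z * w) = cabs z * cabs w.
Proof. by apply: cabs_inj; rewrite normrM -!cabsE -rmorphM. Qed.

Lemma cabsV w : cabs w^-1 = (cabs w)^-1.
Proof. by apply: cabs_inj; rewrite normfV -!cabsE -fmorphV. Qed.

Lemma cabs_real r : cabs (r%:C)%C = `|r|.
Proof. by rewrite /cabs /enorm /= expr0n /= addr0 sqrtr_sqr. Qed.

Lemma cabs_conj w : cabs w^*%C = cabs w.
Proof. by case: w => a b; rewrite /cabs /enorm /= sqrrN. Qed.

Lemma cabs_toC x : cabs (toC x) = enorm x.
Proof. by case: x. Qed.

Lemma cabs_bounds x w r : closed_disc x -> cabs w = r ->
  r - 1 <= cabs (toC x + w) <= r + 1.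
Proof.
rewrite /closed_disc /= => x1 wr.
have E : ofC (toC x + w) = x + ofC w by case: w {wr}; case: x {x1}.
have := ler_enorm_dist (ofC w) (- x); rewrite enormN opprK (addrC (ofC w)) ler_norml.
rewrite /cabs E; have := enormD x (ofC w); move: wr; rewrite /cabs => ->; lra.
Qed.

Lemma enorm_ofCB z w : enorm (ofC z - ofC w) = cabs (z - w).
Proof. by case: z => a b; case: w. Qed.

Lemma cabs_eq0 w : (cabs w == 0) = (w == 0).
Proof. by rewrite -[RHS]normr_eq0 -cabsE;
  exact/esym/(inj_eq (@complexI R) (cabs w) 0). Qed.

Section maps.
Variables (w : R[i]) (r : R).
Hypotheses (r2 : 2 <= r) (wr : cabs w = r).

Lemma f_denom : `|w| ^+ 2 - 1 = ((r ^+ 2 - 1)%:C)%C.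
Proof. by rewrite -cabsE wr rmorphB rmorphXn. Qed.

(** The map is a similarity of ratio 1/(r^2 - 1), split into two equal square roots to fit the
    two-point form. *)
Lemma f_map_dist x y : enorm (f_map w x - f_map w y) =
  (Num.sqrt (r ^+ 2 - 1))^-1 * (Num.sqrt (r ^+ 2 - 1))^-1 * enorm (x - y).
Proof.
have r1 : 0 <= r ^+ 2 - 1 by have := r2; nra.
rewrite enorm_ofCB -mulrBl opprD addrACA subrr addr0 cabsM cabsV f_denom cabs_real.
by rewrite ger0_norm// -toCB cabs_toC -invfM -expr2 sqr_sqrtr// mulrC.
Qed.

Lemma f_map_bounds x : closed_disc x ->
  (r + 1)^-1 <= enorm (f_map w x) <= (r - 1)^-1.
Proof.
move=> x1; have := cabs_bounds x1 (etrans (cabs_conj w) wr).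
rewrite -[enorm _]/(cabs _) cabsM cabsV f_denom cabs_real.
have hr := r2.
have r1 : 0 < r ^+ 2 - 1 by nra.
have rE : r ^+ 2 - 1 = (r - 1) * (r + 1) by ring.
have p1 : 0 < r - 1 by lra.
have p2 : 0 < r + 1 by lra.
rewrite gtr0_norm// => /andP[l1 l2]; apply/andP; split.
  by rewrite ler_pdivlMr// rE mulrC mulfK ?gt_eqF.
by rewrite ler_pdivrMr// rE mulKf ?gt_eqF.
Qed.

Lemma g_denom x : closed_disc x -> r - 1 <= cabs (toC x + w) <= r + 1.
Proof. by move/cabs_bounds; apply. Qed.

(** Uses 1/p - 1/q = (q - p)/(p q). *)
Lemma g_map_dist x y : closed_disc x -> closed_disc y ->
  enorm (g_map w x - g_map w y) =
  (cabs (toC x + w))^-1 * (cabs (toC y + w))^-1 * enorm (x - y).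
Proof.
move=> x1 y1; have hr := r2.
have nz u : closed_disc u -> toC u + w != 0.
  by move/g_denom => /andP[h _]; rewrite -cabs_eq0 gt_eqF//; lra.
have -> : enorm (g_map w x - g_map w y) =
    cabs ((toC x + w)^-1 * (toC y + w)^-1 * (toC y - toC x)).
  rewrite enorm_ofCB; congr cabs.
  have := nz _ x1; have := nz _ y1; move: (toC x) (toC y) => p q hq hp.
  by field; rewrite hp hq.
by rewrite !cabsM !cabsV -toCB cabs_toC enormB.
Qed.

Lemma g_map_bounds x : closed_disc x ->
  (r + 1)^-1 <= (cabs (toC x + w))^-1 <= (r - 1)^-1.
Proof.
move/g_denom => /andP[h1 h2]; have hr := r2.
by rewrite !lef_pV2 ?h1 ?h2// posrE; lra.
Qed.

End maps.

Lemma gap_seq_ge (d : nat -> R) : gap_seq d -> forall n, 2 + 2 * n%:R <= d n.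
Proof.
move=> [d0 dS]; elim=> [|n IH]; first by rewrite mulr0 addr0.
by have := dS n; rewrite -natr1; lra.
Qed.

Lemma cabs_param (d : nat -> R) (T : nat) (k : nat * 'I_T) : gap_seq d ->
  cabs (param d k) = d k.1.
Proof.
move=> /gap_seq_ge/(_ k.1) dk; rewrite /param cabsM cabs_real ger0_norm; last first.
  have : (0 : R) <= k.1%:R by []; lra.
by rewrite /cabs /enorm /ecirc /= cos2Dsin2 sqrtr1 mul1r.
Qed.

Lemma gap_seq_ge2 (d : nat -> R) n : gap_seq d -> 2 <= d n.
Proof. by move=> /gap_seq_ge/(_ n); have : (0 : R) <= n%:R by []; lra. Qed.

Lemma gap_seq_finite (d : nat -> R) (T : nat) (M : R) : gap_seq d ->
  finite_set [set k : nat * 'I_T | d k.1 <= M].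
Proof.
move=> hd; apply: (@sub_finite_set _ _ (`I_((Num.truncn M).+1) `*` [set: 'I_T])).
  move=> [n j] /= dM; split => //=.
  have : n%:R < (Num.truncn M).+1%:R :> R.
    apply: le_lt_trans (truncnS_gt M); apply: le_trans dM.
    by have := gap_seq_ge hd n; have : (0 : R) <= n%:R by []; lra.
  by rewrite ltr_nat.
by apply: finite_setX; [exact: finite_II|exact: finite_finset].
Qed.

Lemma gap_seq_unbounded (d : nat -> R) (T : nat) (M : R) : gap_seq d -> (0 < T)%N ->
  exists k : nat * 'I_T, M < d k.1.
Proof.
move=> hd hT; exists ((Num.truncn M).+1, Ordinal hT) => /=.
apply: lt_le_trans (truncnS_gt M) _.
have := gap_seq_ge hd (Num.truncn M).+1; have : (0 : R) <= (Num.truncn M).+1%:R by [].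
lra.
Qed.

Lemma disc_system_F (d : nat -> R) (T : nat) : gap_seq d -> (0 < T)%N ->
  disc_system (@sysF R d T) (fun k => d k.1)
    (fun k _ => (Num.sqrt (d k.1 ^+ 2 - 1))^-1).
Proof.
move=> hd hT; split.
- by move=> k; exact: gap_seq_ge2.
- by move=> k x y _ _; apply: f_map_dist; [exact: gap_seq_ge2|exact: cabs_param].
- move=> k x _; have r2 := gap_seq_ge2 k.1 hd.
  have q0 : 0 <= d k.1 ^+ 2 - 1 by nra.
  have p1 : 0 <= d k.1 - 1 by lra.
  have p2 : 0 <= d k.1 + 1 by lra.
  have s0 : 0 < Num.sqrt (d k.1 ^+ 2 - 1) by rewrite sqrtr_gt0; nra.
  rewrite !lef_pV2 ?posrE//; try lra.
  (* Compared after squaring: r^2 - 1 lies between (r - 1)^2 and (r + 1)^2. *)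
  have := sqr_sqrtr q0; move: (Num.sqrt _) s0 => q q00 qE.
  by apply/andP; split; rewrite -(@ler_pXn2r _ 2) ?nnegrE ?(ltW q00)// qE; nra.
- by move=> k x; apply: f_map_bounds; [exact: gap_seq_ge2|exact: cabs_param].
- by move=> M; exact: gap_seq_finite.
- by move=> M; exact: gap_seq_unbounded.
Qed.

Lemma disc_system_G (d : nat -> R) (T : nat) : gap_seq d -> (0 < T)%N ->
  disc_system (@sysG R d T) (fun k => d k.1)
    (fun k x => (cabs (toC x + param d k))^-1).
Proof.
move=> hd hT; split.
- by move=> k; exact: gap_seq_ge2.
- by move=> k x y; apply: (g_map_dist (r := d k.1));
    [exact: gap_seq_ge2|exact: cabs_param].
- by move=> k x; apply: g_map_bounds; [exact: gap_seq_ge2|exact: cabs_param].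
(* Here the norm of the image equals [rho k x], so both pairs of bounds coincide. *)
- move=> k x x1; rewrite -[enorm _]/(cabs _) cabsV.
  by apply: g_map_bounds x1; [exact: gap_seq_ge2|exact: cabs_param].
- by move=> M; exact: gap_seq_finite.
- by move=> M; exact: gap_seq_unbounded.
Qed.

End systems.

Theorem theorem1 (R : realType) (d : nat -> R) (T : nat)
    (hd : gap_seq d) (hT : (0 < T)%N) :
  (forall (F : cifs closed_disc (@sysF R d T)) (h : R)
      (m : probability (plane R) R),
    regular F ->
    hausdorff_dim (limit_set closed_disc (@sysF R d T)) = h%:E ->
    conformal_measure F h m ->
    (pressure F (h / 2) < +oo)%E ->
    limf_esup (fun r : R => (m (eball 0%R r) * ((r `^ h)^-1)%:E)%E) (0 : R)^'+
      = 0%E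
    /\ packing_measure h (limit_set closed_disc (@sysF R d T)) = +oo%E)
  /\
  (forall (G : cifs closed_disc (@sysG R d T)) (h : R)
      (m : probability (plane R) R),
    regular G ->
    hausdorff_dim (limit_set closed_disc (@sysG R d T)) = h%:E ->
    conformal_measure G h m ->
    (pressure G (h / 2) < +oo)%E ->
    limf_esup (fun r : R => (m (eball 0%R r) * ((r `^ h)^-1)%:E)%E) (0 : R)^'+
      = 0%E
    /\ packing_measure h (limit_set closed_disc (@sysG R d T)) = +oo%E).
Proof.
split=> [F|G] h m _ _.
  exact: disc_cifs_thin (disc_system_F hd hT) F h m.
exact: disc_cifs_thin (disc_system_G hd hT) G h m.
Qed.
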